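(* The decision problem FireFighting — given a graph $G$ and $m\in\mathbb{N}_{>0}$, decide whether $\text{ffn}(G)\le m$ — is NP-hard.
   Context: All graphs are finite, simple and undirected. For a graph $G=(V,E)$ and $W\subseteq V$, $N(W)$ is the set of nodes in $V\setminus W$ adjacent to at least one node of $W$. For $m\in\mathbb{N}_{>0}$, an $m$-strategy of length $T$ is a sequence $(F_1,\dots,F_T)$ of subsets of $V$ with $|F_i|\le m$. Its burning sets are $B_0=V$ and $B_t=(B_{t-1}\setminus F_t)\cup N(B_{t-1}\setminus F_t)$ for $t\ge1$, where $F_t=\emptyset$ for $t>T$. The strategy is winning if $B_T=\emptyset$. The firefighter number $\text{ffn}(G)$ is the smallest $m$ for which a winning $m$-strategy for $G$ exists. *)

(* Defs.v *)
From HB Require Import structures.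
From mathcomp Require Import all_boot all_order all_algebra.
From mathcomp Require Import boolp.

Set Implicit Arguments.
Unset Strict Implicit.
Unset Printing Implicit Defensive.

Record sgraph (V : finType) := SGraph {
  adj :> rel V;
  adj_sym : symmetric adj;
  adj_irr : irreflexive adj
}.

Section FireFighter.
Variables (V : finType) (G : sgraph V).

Definition nbhd (W : {set V}) : {set V} :=
  [set v | (v \notin W) && [exists w in W, adj G w v]].

(* A strategy (F_1, ..., F_T) is the sequence F of size T whose item of index
   t is F_{t+1}; reading past the end gives the empty set. *)
Fixpoint burning (F : seq {set V}) (t : nat) : {set V} :=
  if t is t'.+1 then
    let W := burning F t' :\: nth set0 F t' in W :|: nbhd W
  else setT.

Definition strategy (m : nat) (F : seq {set V}) : Prop :=
  forall A, A \in F -> #|A| <= m.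

Definition winning (F : seq {set V}) : Prop := burning F (size F) = set0.

Definition winnable (m : nat) : Prop :=
  0 < m /\ exists F, strategy m F /\ winning F.

Lemma winnable_ex : exists m, `[< winnable m >].
Proof.
exists #|V|.+1; apply/asboolP; split=> //; exists [:: setT]; split.
  by move=> A _; apply: leq_trans (max_card _) (leqnSn _).
rewrite /winning /= setDT set0U; apply/setP=> v; rewrite !inE /=.
by apply/existsP=> -[w]; rewrite inE.
Qed.

Definition ffn : nat := ex_minn winnable_ex.

End FireFighter.

Inductive move := MoveL | MoveS | MoveR.

Definition move_to (d : move) : option bool :=
  match d with MoveL => Some false | MoveS => None | MoveR => Some true end.
Definition move_of (o : option bool) : move :=
  match o with Some false => MoveL | None => MoveS | Some true => MoveR end.
Lemma move_toK : cancel move_to move_of. Proof. by case. Qed.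
HB.instance Definition _ := Finite.copy move (can_type move_toK).

(* Tape symbols over the auxiliary alphabet A: None is the blank and
   Some (inl b) is the input/output bit b. *)
Definition sym (A : finType) : finType := option (bool + A)%type.

(* Nondeterministic Turing machine with (extra M).+1 tapes. A machine has no
   separate halting states: it halts when no transition applies. *)
Record TM := MkTM {
  extra : nat;
  aux : finType;
  state : finType;
  start : state;
  accepting : {set state};
  trans : state -> {ffun 'I_extra.+1 -> sym aux} ->
          {set state * {ffun 'I_extra.+1 -> sym aux * move}}
}.

Definition deterministic (M : TM) : Prop :=
  forall (q : state M) r, #|trans q r| <= 1.

(* (l, a, r) is the two-way infinite tape whose head reads a, with l to the
   left of the head (nearest cell first), r to the right, blanks beyond. *)
Definition tape (A : finType) := (seq (sym A) * sym A * seq (sym A))%type.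

Definition move_tape A (d : move) (x : tape A) : tape A :=
  let: (l, a, r) := x in
  match d with
  | MoveL => (behead l, head None l, a :: r)
  | MoveS => x
  | MoveR => (a :: l, head None r, behead r)
  end.

Definition write_move A (y : sym A * move) (x : tape A) : tape A :=
  let: (l, _, r) := x in move_tape y.2 (l, y.1, r).

Definition input_tape A (w : seq bool) : tape A :=
  let s := [seq Some (inl b) : sym A | b <- w] in
  ([::], head None s, behead s).

Fixpoint bit_prefix A (s : seq (sym A)) : seq bool :=
  if s is Some (inl b) :: s' then b :: bit_prefix s' else [::].

(* The output is the maximal block of bits starting at the head. *)
Definition output A (x : tape A) : seq bool :=
  let: (_, a, r) := x in bit_prefix (a :: r).

Section Runs.
Variable M : TM.

Definition config := (state M * {ffun 'I_(extra M).+1 -> tape (aux M)})%type.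

Definition init (w : seq bool) : config :=
  (start M, [ffun i => input_tape (aux M) (if i == ord0 then w else [::])]).

Definition options (c : config) := trans c.1 [ffun i => (c.2 i).1.2].

Definition step (c c' : config) : Prop :=
  exists2 a, a \in options c &
    c' = (a.1, [ffun i => write_move (a.2 i) (c.2 i)]).

Fixpoint steps (n : nat) (c c' : config) : Prop :=
  if n is n'.+1 then exists2 d, step c d & steps n' d c' else c = c'.

Definition halted (c : config) : Prop := options c = set0.

(* Every computation path, accepting or not, obeys the time bound. *)
Definition poly_time : Prop :=
  exists p : {poly nat},
    forall w n c, steps n (init w) c -> n <= p.[size w]%R.

Definition accepts (w : seq bool) : Prop :=
  exists n c, [/\ steps n (init w) c, halted c & c.1 \in accepting M].

Definition computes (f : seq bool -> seq bool) : Prop :=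
  forall w, exists n c,
    [/\ steps n (init w) c, halted c & output (c.2 ord0) = f w].

End Runs.

Definition language := seq bool -> Prop.

Definition NP (L : language) : Prop :=
  exists M : TM, poly_time M /\ forall w, L w <-> accepts M w.

Definition poly_computable (f : seq bool -> seq bool) : Prop :=
  exists M : TM, [/\ deterministic M, poly_time M & computes M f].

Definition poly_reducible (L L' : language) : Prop :=
  exists f, poly_computable f /\ forall w, L w <-> L' (f w).

Definition NP_hard (L : language) : Prop :=
  forall L', NP L' -> poly_reducible L' L.

(* Binary digits of m > 0, least significant first. *)
Definition binary (m : nat) : seq bool :=
  mkseq (fun i => odd (m %/ 2 ^ i)) (trunc_log 2 m).+1.

(* 1^n 0, then the n * n bits of the adjacency matrix in row-major order,
   then m in binary. *)
Definition encode (n : nat) (G : sgraph 'I_n) (m : nat) : seq bool :=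
  nseq n true ++ false ::
  [seq adj G i j | i <- enum 'I_n, j <- enum 'I_n] ++ binary m.

Definition FireFighting : language := fun w =>
  exists (n : nat) (G : sgraph 'I_n) (m : nat),
    [/\ 0 < m, w = encode G m & ffn G <= m].

(* Main.v *)
From HB Require Import structures.
From mathcomp Require Import all_boot all_algebra.
From mathcomp Require Import boolp zify.
Require Import Defs.

Set Implicit Arguments.
Unset Strict Implicit.
Unset Printing Implicit Defensive.

(** Acceptance of a nondeterministic machine is a clique problem: an event is a
    time together with the local data read, written and guessed there (the
    state, the symbols under the heads, the head positions and, for every tape,
    the last time the current cell was visited), and a run is a choice of one
    event for every time such that all pairs are compatible; compatibility
    involves two events only because the last visits are guessed.

    A clique problem becomes a firefighter problem by blowing up the vertices of
    a split graph into classes of twins.  The clique of the split graph has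
    exactly m vertices.  As long as some of them is not protected, the clean set
    is a set S of independent classes, and it can only grow while enough of the
    clique is not adjacent to S.  Once the clique is protected entirely, S can
    only grow if enough of the clique is adjacent to nothing outside S.  The
    weights are such that both conditions can be met iff some set of at most k
    points spans k^2 ordered compatible pairs.

    The adjacency matrix is a quantifier-free condition on the digits of the two
    indices, so it is printed by nested loops over unary counters, which a
    multi-tape machine runs with one stack per tape. *)

(** * Clearing sets *)

Section Clearing.
Variables (V : finType) (G : sgraph V) (m : nat).

Definition interior (Y : {set V}) : {set V} :=
  [set x | [forall y, ((y == x) || adj G y x) ==> (y \in Y)]].

Lemma interiorP (Y : {set V}) x :
  reflect (x \in Y /\ forall y, adj G y x -> y \in Y) (x \in interior Y).
Proof.
rewrite inE; apply: (iffP forallP) => [intY|[xY nbY] y].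
  split=> [|y yx]; first by have := intY x; rewrite eqxx.
  by have := intY y; rewrite yx orbT.
by apply/implyP=> /orP[/eqP->//|]; apply: nbY.
Qed.

Lemma interiorS (Y Z : {set V}) : Y \subset Z -> interior Y \subset interior Z.
Proof.
move=> /subsetP YZ; apply/subsetP=> x /interiorP[xY nbY].
by apply/interiorP; split=> [|y /nbY]; apply: YZ.
Qed.

Lemma setC_burningS F t :
  ~: burning G F t.+1 = interior (~: burning G F t :|: nth set0 F t).
Proof.
apply/setP=> x; rewrite -[burning G F t.+1]/(_ :|: nbhd G _) -setCD.
move: (_ :\: _) => W; rewrite inE in_setU negb_or.
apply/andP/interiorP => [[xW]|[]]; rewrite !inE.
  rewrite xW => /existsP noW; split=> // y yx; rewrite inE.
  by apply/negP=> yW; apply: noW; exists y; rewrite yW.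
move=> xW nbW; split=> //; rewrite xW; apply/existsP=> -[y /andP[yW /nbW]].
by rewrite inE yW.
Qed.

Lemma burning_rcons F A t :
  t <= size F -> burning G (rcons F A) t = burning G F t.
Proof.
elim: t => // t IHt tF; rewrite /= IHt ?(ltnW tF) //.
by rewrite nth_rcons tF.
Qed.

Definition clears (C : {set V}) :=
  exists F, strategy m F /\ C \subset ~: burning G F (size F).

Lemma clears0 : clears set0.
Proof. by exists [::]; split=> //; rewrite sub0set. Qed.

Lemma clearsS (C D : {set V}) : D \subset C -> clears C -> clears D.
Proof.
by move=> DC [F [sF CF]]; exists F; split=> //; apply: subset_trans CF.
Qed.

Lemma clears_interior (C A : {set V}) :
  clears C -> #|A| <= m -> clears (interior (C :|: A)).
Proof.
case=> F [sF CF] Am; exists (rcons F A); split.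
  by move=> D; rewrite mem_rcons inE => /predU1P[->|/sF].
rewrite size_rcons setC_burningS burning_rcons // nth_rcons ltnn eqxx.
by apply: interiorS; apply: setSU.
Qed.

Lemma winnable_clears : 0 < m -> winnable G m <-> clears setT.
Proof.
move=> m0; split=> [[_ [F [sF wF]]]|[F [sF wF]]].
  by exists F; split=> //; rewrite wF setC0.
split=> //; exists F; split=> //.
by apply/eqP; rewrite -subset0 -setCS setC0.
Qed.

Lemma setC_burning_ind (P : {set V} -> Prop) F t :
  strategy m F -> P set0 ->
  (forall C A : {set V}, P C -> #|A| <= m -> P (interior (C :|: A))) ->
  P (~: burning G F t).
Proof.
move=> sF P0 PS; elim: t => [|t IHt]; first by rewrite /= setCT.
rewrite setC_burningS; apply: PS => //.
have [tF|tF] := ltnP t (size F); first exact/sF/mem_nth.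
by rewrite nth_default // cards0.
Qed.

End Clearing.

Lemma winnable_mono (V : finType) (G : sgraph V) m m' :
  m <= m' -> winnable G m -> winnable G m'.
Proof.
move=> mm' [m0 [F [sF wF]]]; split; first exact: leq_trans mm'.
by exists F; split=> // A /sF /leq_trans; apply.
Qed.

Lemma ffn_leP (V : finType) (G : sgraph V) m : ffn G <= m <-> winnable G m.
Proof.
rewrite /ffn; case: ex_minnP => m' /asboolP wm' min_m'.
split=> [/winnable_mono|wm]; first exact.
by apply: min_m'; apply/asboolP.
Qed.

(** * Blow-ups of split graphs *)

Lemma card_fibers (X C : finType) (f : X -> C) (P : pred C) :
  #|[set x | P (f x)]| = \sum_(c | P c) #|[set x | f x == c]|.
Proof.
rewrite -sum1_card (partition_big f P) /= => [|x]; last by rewrite inE.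
apply: eq_bigr => c Pc; rewrite -sum1_card; apply: eq_bigl => x.
by rewrite !inE andb_idl // => /eqP->.
Qed.

Definition split_link O Q (eqO : rel O) (inc : Q -> pred O) (c d : O + Q) :
  bool :=
  match c, d with
  | inl o, inl o' => eqO o o'
  | inl o, inr q | inr q, inl o => inc q o
  | inr _, inr _ => true
  end.

Section SplitBlowup.
Variables (O Q : finType) (inc : Q -> pred O).
Variables (X : finType) (G : sgraph X) (cl : X -> O + Q).
Hypothesis adjE :
  forall x y, adj G x y = (x != y) && split_link eq_op inc (cl x) (cl y).

Definition twins (c : O + Q) : {set X} := [set x | cl x == c].
Definition weight c := #|twins c|.

Definition indep_part (S : {set O}) : {set X} :=
  [set x | if cl x is inl o then o \in S else false].
Definition clique_part (P : pred Q) : {set X} :=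
  [set x | if cl x is inr q then P q else false].

Definition inside (S : {set O}) : pred Q :=
  fun q => [forall o, inc q o ==> (o \in S)].
Definition outside (S : {set O}) : pred Q :=
  fun q => [forall o, inc q o ==> (o \notin S)].

Definition saturation (S : {set O}) := indep_part S :|: clique_part (inside S).
Definition gain S := #|clique_part (inside S)|.
Definition slack S := #|clique_part (outside S)|.

Local Notation m := #|clique_part predT|.

Lemma card_indep_part S : #|indep_part S| = \sum_(o in S) weight (inl o).
Proof.
rewrite (card_fibers cl (fun c => if c is inl o then o \in S else false)).
by rewrite big_sumType /= [X in _ + X]big_pred0 ?addn0.
Qed.

Lemma card_clique_part P : #|clique_part P| = \sum_(q | P q) weight (inr q).
Proof.
rewrite (card_fibers cl (fun c => if c is inr q then P q else false)).
by rewrite big_sumType /= [X in X + _]big_pred0.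
Qed.

Lemma card_clique_partC P : #|clique_part P| + #|clique_part (predC P)| = m.
Proof.
rewrite -(cardsID (clique_part P) (clique_part predT)); congr (_ + _);
  apply: eq_card => x; rewrite !inE; case: (cl x) => //= q; by rewrite ?andbT.
Qed.

Lemma weight_le_indep_part (S : {set O}) o :
  o \in S -> weight (inl o) <= #|indep_part S|.
Proof. by move=> oS; rewrite card_indep_part (bigD1 o) //= leq_addr. Qed.

Lemma weight2_le_indep_part (S : {set O}) o o' :
  o \in S -> o' \in S -> o != o' ->
  weight (inl o) + weight (inl o') <= #|indep_part S|.
Proof.
move=> oS o'S oo'; rewrite card_indep_part (bigD1 o) //= (bigD1 o') /=.
  by rewrite addnA leq_addr.
by rewrite o'S eq_sym.
Qed.

Lemma mem_inside (S : {set O}) q o : inside S q -> inc q o -> o \in S.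
Proof. by move=> /forallP/(_ o)/implyP. Qed.

Lemma notin_outside (S : {set O}) q o : outside S q -> inc q o -> o \notin S.
Proof. by move=> /forallP/(_ o)/implyP. Qed.

Lemma insideF (S : {set O}) q o : inc q o -> o \notin S -> inside S q = false.
Proof. by move=> qo; apply: contraNF => /mem_inside; apply. Qed.

Lemma outsideF (S : {set O}) q o : inc q o -> o \in S -> outside S q = false.
Proof. by move=> qo; apply: contraTF => /notin_outside; apply. Qed.

Lemma insideT q : inside setT q.
Proof. by apply/forallP=> o; rewrite inE implybT. Qed.

Lemma split_link_refl c : split_link eq_op inc c c.
Proof. by case: c => /=. Qed.

Lemma interior_blowupP (Y : {set X}) x :
  reflect (forall y, split_link eq_op inc (cl y) (cl x) -> y \in Y)
          (x \in interior G Y).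
Proof.
apply: (iffP (interiorP _ _ _)) => [[xY nbY] y yx|linkY].
  by have [->//|nyx] := eqVneq y x; apply: nbY; rewrite adjE nyx.
split=> [|y]; first exact/linkY/split_link_refl.
by rewrite adjE => /andP[_]; apply: linkY.
Qed.

Lemma clears_indep_part (S : {set O}) o :
  weight (inl o) <= slack (o |: S) -> clears G m (indep_part S) ->
  clears G m (indep_part (o |: S)).
Proof.
move=> wo cS; have cost : #|twins (inl o) :|:
    clique_part (predC (outside (o |: S)))| <= m.
  apply: leq_trans (leq_card_setU _ _) _.
  by rewrite -(card_clique_partC (outside (o |: S))) leq_add2r.
apply: clearsS (clears_interior cS cost); apply/subsetP=> x; rewrite inE.
case xE: (cl x) => [o'|//] o'S; apply/interior_blowupP => y; rewrite xE !inE.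
case: (cl y) => [o''|q] /=; last by move=> qo; rewrite (outsideF qo o'S).
by move/eqP->; move: o'S; rewrite !inE => /orP[/eqP->|->]; rewrite ?eqxx ?orbT.
Qed.

Lemma clears_saturation (S : {set O}) :
  clears G m (indep_part S) -> clears G m (saturation S).
Proof.
move/clears_interior=> /(_ (clique_part predT) (leqnn _)); apply: clearsS.
apply/subsetP=> x xS; apply/interior_blowupP => y; move: xS; rewrite !inE.
case: (cl y) => [o|q]; last by rewrite orbT.
case: (cl x) => [o'|q] /=; first by rewrite !orbF => ? /eqP->.
by move=> qS /(mem_inside qS)->.
Qed.

Lemma clears_saturationU1 (S : {set O}) o :
  weight (inl o) <= gain S -> clears G m (saturation S) ->
  clears G m (saturation (o |: S)).
Proof.
move=> wo cS; have cost : #|twins (inl o) :|: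
    clique_part (predC (inside S))| <= m.
  apply: leq_trans (leq_card_setU _ _) _.
  by rewrite -(card_clique_partC (inside S)) leq_add2r.
apply: clearsS (clears_interior cS cost); apply/subsetP=> x xS.
apply/interior_blowupP => y; rewrite !inE.
case: (cl y) => [o'|q] /=; last by case: (inside S q).
have [->|o'o] := eqVneq o' o; first by rewrite eqxx !orbT.
move: xS; rewrite !inE; case: (cl x) => [o''|q] /=.
  by rewrite orbF !inE => + /eqP o'E; rewrite -o'E (negPf o'o) /= => ->.
by move=> qS /(mem_inside qS); rewrite !inE (negPf o'o) /= => ->.
Qed.

Lemma cost_le (T : {set O}) (P : pred Q) (A : {set X}) :
  indep_part T \subset A -> clique_part P \subset A ->
  #|indep_part T| + #|clique_part P| <= #|A|.
Proof.
move=> TA PA; have disj : indep_part T :&: clique_part P = set0.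
  by apply/setP=> x; rewrite !inE; case: (cl x) => // q; rewrite andbF.
rewrite -cardsUI disj cards0 addn0.
by rewrite subset_leq_card // subUset TA.
Qed.

Lemma clique_part_cover (P P' : pred Q) :
  m <= #|clique_part P| + #|clique_part P'|
       + #|clique_part (fun q => ~~ P q && ~~ P' q)|.
Proof.
rewrite -addnA -(card_clique_partC P) leq_add2l.
apply: leq_trans (leq_card_setU _ _).
apply: subset_leq_card; apply/subsetP => x; rewrite !inE.
by case: (cl x) => //= q ->; case: (P' q).
Qed.

Section Step.
Variables (S : {set O}) (C A : {set X}).
Hypotheses (CS : C \subset saturation S) (Am : #|A| <= m).
Local Notation Y := (C :|: A).

Lemma mem_protected x : x \in Y -> x \notin saturation S -> x \in A.
Proof. by rewrite inE => /orP[/(subsetP CS)->|]. Qed.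

Lemma fiber_sub_gained o :
  clique_part predT \subset Y -> twins (inl o) \subset Y ->
  (o \notin S -> gain S < weight (inl o)) -> o \in S.
Proof.
move=> /subsetP QY /subsetP oY gain_lt; apply: contraT => oS.
have : #|indep_part [set o]| + #|clique_part (predC (inside S))| <= #|A|.
  apply: cost_le; apply/subsetP=> x; rewrite inE.
    case xE: (cl x) => [o'|//]; rewrite inE => /eqP o'o.
    by apply: mem_protected; rewrite ?oY ?inE ?xE ?o'o ?orbF.
  case xE: (cl x) => [//|q] /= /negPf qS.
  by apply: mem_protected; rewrite ?QY ?inE ?xE ?qS.
rewrite card_indep_part big_set1 => /leq_trans/(_ Am).
by rewrite -(card_clique_partC (inside S)) leq_add2r leqNgt gain_lt.
Qed.

Lemma interior_protected :
  clique_part predT \subset Y ->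
  (forall o, o \notin S -> gain S < weight (inl o)) ->
  interior G Y \subset saturation S.
Proof.
move=> QY gain_lt.
have inS o : twins (inl o) \subset Y -> o \in S.
  by move=> oY; apply: fiber_sub_gained QY oY _; apply: gain_lt.
apply/subsetP=> x /interior_blowupP xY; rewrite !inE.
case xE: (cl x) xY => [o|q] xY.
  rewrite orbF; apply: inS; apply/subsetP=> y; rewrite inE => /eqP yo.
  by apply: xY; rewrite yo split_link_refl.
apply/forallP=> o; apply/implyP=> qo; apply: inS; apply/subsetP=> y.
by rewrite inE => /eqP yo; apply: xY; rewrite yo.
Qed.

Definition cleared_classes : {set O} :=
  [set o | [exists x in interior G Y, cl x == inl o]].
Local Notation S' := cleared_classes.

Lemma interior_unprotected :
  ~~ (clique_part predT \subset Y) -> interior G Y \subset indep_part S'.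
Proof.
case/subsetPn=> x0; rewrite !inE => Qx0 x0Y; apply/subsetP=> x xY.
move: (xY) => /interior_blowupP/(_ x0); rewrite !inE.
case x0E: (cl x0) Qx0 => [//|q0] _; case xE: (cl x) => [o|q] /=.
  by move=> _; rewrite inE; apply/existsP; exists x; rewrite xY xE eqxx.
by move=> /(_ isT); rewrite (negPf x0Y).
Qed.

Lemma card_cleared_classes :
  #|indep_part (S' :\: S)| <= slack S' + gain S.
Proof.
have inY o y : o \in S' -> split_link eq_op inc (cl y) (inl o) -> y \in Y.
  rewrite inE => /existsP[x /andP[/interior_blowupP xY /eqP <-]]; exact: xY.
have : #|indep_part (S' :\: S)| +
       #|clique_part (fun q => ~~ outside S' q && ~~ inside S q)| <= #|A|.
  apply: cost_le; apply/subsetP=> x; rewrite inE.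
    case xE: (cl x) => [o|//]; rewrite inE => /andP[oS oS'].
    apply: mem_protected; last by rewrite !inE xE orbF.
    by apply: inY oS' _; rewrite xE split_link_refl.
  case xE: (cl x) => [//|q] /andP[/forallPn[o]].
  rewrite negb_imply negbK => /andP[qo oS'] qS.
  apply: mem_protected; last by rewrite !inE xE.
  by apply: inY oS' _; rewrite xE.
move/leq_trans/(_ Am)/leq_trans/(_ (clique_part_cover (outside S') (inside S))).
by rewrite leq_add2r.
Qed.

Lemma saturation_step :
  (forall o, o \notin S -> gain S < weight (inl o)) ->
  exists2 T, interior G Y \subset saturation T &
    T = S \/ ~~ (T \subset S) /\ #|indep_part (T :\: S)| <= slack T + gain S.
Proof.
move=> gain_lt; have [QY|nQY] := boolP (clique_part predT \subset Y).
  by exists S; [exact: interior_protected | left].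
have iS' := interior_unprotected nQY; have [SS|nSS] := boolP (S' \subset S).
  exists S; last by left.
  apply: subset_trans iS' _; apply: subset_trans (subsetUl _ _).
  by apply/subsetP=> x; rewrite !inE; case: (cl x) => // o /(subsetP SS).
exists S'; first exact: subset_trans iS' (subsetUl _ _).
by right; split=> //; apply: card_cleared_classes.
Qed.

End Step.
End SplitBlowup.

(** * The clique gadget *)

Lemma set_ind (T : finType) (P : {set T} -> Prop) :
  P set0 -> (forall x (A : {set T}), x \notin A -> P A -> P (x |: A)) ->
  forall A, P A.
Proof.
move=> P0 PU A; have [n] := ubnP #|A|; elim: n A => // n IHn A /ltnSE An.
have [->//|/set0Pn[x xA]] := eqVneq A set0; rewrite -(setD1K xA).
apply: PU; first by rewrite !inE eqxx.
by apply: IHn; apply: leq_trans An; rewrite (cardsD1 x A) xA.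
Qed.

Section EdgesWithin.
Variables (V : finType) (E : rel V).

Definition edges_within (U : {set V}) : {set V * V} :=
  [set p | [&& p.1 \in U, p.2 \in U & E p.1 p.2]].

Lemma edges_withinS (U : {set V}) : edges_within U \subset setX U U.
Proof. by apply/subsetP=> -[u v]; rewrite !inE /= => /and3P[-> ->]. Qed.

Lemma card_edges_within_clique (U : {set V}) :
  {in U &, forall u v, E u v} -> #|edges_within U| = #|U| * #|U|.
Proof.
move=> EU; rewrite -cardsX; congr #|pred_of_set _|; apply/eqP.
rewrite eqEsubset edges_withinS; apply/subsetP=> -[u v].
by rewrite !inE /= => /andP[uU vU]; rewrite uU vU EU.
Qed.

Lemma edges_within_full n (U : {set V}) :
  #|U| <= n -> n * n <= #|edges_within U| ->
  #|U| = n /\ {in U &, forall u v, E u v}.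
Proof.
move=> Un nE; have EX := subset_leq_card (edges_withinS U).
rewrite cardsX in EX; have nU := leq_trans nE EX.
have cU : #|U| = n.
  apply/eqP; rewrite eqn_leq Un leqNgt; apply/negP=> lt.
  by have := ltn_mul lt lt; rewrite ltnNge nU.
split=> // u v uU vU; have : (u, v) \in edges_within U; last first.
  by rewrite inE => /and3P[].
have /eqP -> : edges_within U == setX U U.
  by rewrite eqEcard edges_withinS cardsX cU.
by rewrite inE uU.
Qed.

End EdgesWithin.

Inductive indep_class (V : Type) :=
  Point of V | EdgeGate | TwinGate | PointGate | Key.
Arguments EdgeGate {V}.
Arguments TwinGate {V}.
Arguments PointGate {V}.
Arguments Key {V}.

Inductive clique_class (V : Type) := EdgeOf of V & V | PointOf of V | Hub.
Arguments Hub {V}.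

Definition indep_code V (o : indep_class V) : V + bool * bool :=
  match o with
  | Point v => inl v
  | EdgeGate => inr (false, false)
  | TwinGate => inr (false, true)
  | PointGate => inr (true, false)
  | Key => inr (true, true)
  end.
Definition indep_decode V (o : V + bool * bool) : indep_class V :=
  match o with
  | inl v => Point v
  | inr (false, false) => EdgeGate
  | inr (false, true) => TwinGate
  | inr (true, false) => PointGate
  | inr (true, true) => Key
  end.
Lemma indep_codeK V : cancel (@indep_code V) (@indep_decode V).
Proof. by case. Qed.

Definition clique_code V (q : clique_class V) : V * V + (V + unit) :=
  match q with
  | EdgeOf u v => inl (u, v)
  | PointOf v => inr (inl v)
  | Hub => inr (inr tt)
  end.
Definition clique_decode V (q : V * V + (V + unit)) : clique_class V :=
  match q with
  | inl (u, v) => EdgeOf u v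
  | inr (inl v) => PointOf v
  | inr (inr _) => Hub
  end.
Lemma clique_codeK V : cancel (@clique_code V) (@clique_decode V).
Proof. by case. Qed.
Lemma clique_decodeK V : cancel (@clique_decode V) (@clique_code V).
Proof. by case=> [[]|[|[]]]. Qed.

HB.instance Definition _ (V : finType) :=
  Finite.copy (indep_class V) (can_type (@indep_codeK V)).
HB.instance Definition _ (V : finType) :=
  Finite.copy (clique_class V) (can_type (@clique_codeK V)).

(* EdgeGate and TwinGate have the same neighbours: one of them could be cleared
   with the help of the classes gained through PointGate and Key, but not both
   at once. *)
Definition incident V (eqV : rel V) (q : clique_class V) (o : indep_class V) :=
  match q, o with
  | EdgeOf u v, Point x => eqV x u || eqV x v
  | PointOf v, Point x => eqV x v
  | Hub, Point _ => false
  | EdgeOf _ _, (EdgeGate | TwinGate) => true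
  | PointOf _, (PointGate | Key) => true
  | Hub, (EdgeGate | TwinGate | Key) => true
  | _, _ => false
  end.

Definition indep_eq V (eqV : rel V) (o o' : indep_class V) :=
  match o, o' with
  | Point x, Point y => eqV x y
  | EdgeGate, EdgeGate | TwinGate, TwinGate => true
  | PointGate, PointGate | Key, Key => true
  | _, _ => false
  end.

Definition class_link V (eqV : rel V) :=
  split_link (indep_eq eqV) (incident eqV).

Lemma class_linkE (V : finType) (c d : indep_class V + clique_class V) :
  class_link eq_op c d = split_link eq_op (incident eq_op) c d.
Proof. by case: c d => [[x||||]|q] [[y||||]|q']. Qed.

Lemma class_link_sym V (eqV : rel V) : symmetric eqV ->
  symmetric (class_link eqV).
Proof.
by move=> sym [[x||||]|q] [[y||||]|q'] //=; apply: sym.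
Qed.

Section Gadget.
Variables (V : finType) (E : rel V).
Local Notation O := (indep_class V).
Local Notation Q := (clique_class V).
Local Notation inc := (@incident V eq_op).
Variables (k a L c : nat) (X : finType) (G : sgraph X) (cl : X -> O + Q).
Hypothesis adjE :
  forall x y, adj G x y = (x != y) && class_link eq_op (cl x) (cl y).
Local Notation wt := (weight cl).
Hypothesis weight_indep : forall o, o != Key -> wt (inl o) = L.
Hypothesis weight_Key : wt (inl Key) = c.
Hypothesis weight_EdgeOf : forall u v, wt (inr (EdgeOf u v)) = E u v.
Hypothesis weight_PointOf : forall v, wt (inr (PointOf v)) = a.
Hypothesis weight_Hub : L <= wt (inr Hub).
Hypotheses (kV : k < #|V|) (LE : L = a * (#|V| - k)).
Hypotheses (c_gt0 : 0 < c) (c_le_a : c <= a) (c2_le_L : c.*2 <= L).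

Local Notation clique_part := (clique_part cl).
Local Notation inside := (inside inc).
Local Notation outside := (outside inc).
Local Notation gain := (gain inc cl).
Local Notation slack := (slack inc cl).
Local Notation saturation := (saturation inc cl).
Local Notation m := #|clique_part predT|.

Lemma adj_split x y :
  adj G x y = (x != y) && split_link eq_op inc (cl x) (cl y).
Proof. by rewrite adjE class_linkE. Qed.

Definition points (S : {set O}) : {set V} := [set v | Point v \in S].

Lemma card_clique_partE (P : pred Q) :
  #|clique_part P| = #|[set p : V * V | P (EdgeOf p.1 p.2) && E p.1 p.2]|
    + a * #|[set v | P (PointOf v)]| + (if P Hub then wt (inr Hub) else 0).
Proof.
rewrite card_clique_part (reindex (@clique_decode V)) /=; last first.
  by exists (@clique_code V) => q _; rewrite ?clique_codeK ?clique_decodeK.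
rewrite !big_sumType /= -addnA; congr (_ + (_ + _)).
- rewrite big_mkcond -sum1_card [in RHS]big_mkcond; apply: eq_bigr => -[u v] _.
  by rewrite inE weight_EdgeOf /=; case: (P _); case: (E u v).
- rewrite mulnC -sum_nat_const; apply: eq_big => [v|v _]; first by rewrite inE.
  exact: weight_PointOf.
- by rewrite big_mkcond (big_pred1 tt) // => -[].
Qed.

Section Sufficiency.
Variable U : {set V}.
Hypotheses (Uk : #|U| <= k) (cU : c <= #|edges_within E U|).

Definition opening : {set O} :=
  [set o | match o with
           | Point v => v \in U | EdgeGate | TwinGate => true | _ => false
           end].

Lemma slack_ge_L (S : {set O}) : S \subset opening -> L <= slack S.
Proof.
move/subsetP=> SU; rewrite /slack card_clique_partE LE -addnA addnCA.
apply: leq_trans (leq_addr _ _); rewrite leq_mul2l; apply/orP; right.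
apply: (@leq_trans #|~: U|); first by rewrite cardsCs setCK leq_sub2l.
apply: subset_leq_card; apply/subsetP => v; rewrite !inE => vU.
apply/forallP=> o; apply/implyP=> vo; apply/negP => /SU; rewrite inE.
by case: o vo => // x /eqP->; rewrite (negPf vU).
Qed.

Lemma clears_opening (S : {set O}) :
  S \subset opening -> clears G m (indep_part cl S).
Proof.
elim/set_ind: S => [_|o S oS IHS SU].
  apply: clearsS (clears0 _ _); apply/subsetP=> x; rewrite !inE.
  by case: (cl x) => // o; rewrite inE.
apply: (clears_indep_part adj_split); last first.
  by apply: IHS; apply: subset_trans SU; apply: subsetUr.
rewrite weight_indep ?slack_ge_L //; apply/eqP=> oE.
by have := subsetP SU o; rewrite !inE eqxx oE => /(_ isT).
Qed.

Lemma gain_ge_c (S : {set O}) : opening \subset S -> c <= gain S.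
Proof.
move/subsetP=> US; apply: leq_trans cU _;
  rewrite /gain card_clique_partE -addnA.
apply: leq_trans (leq_addr _ _); apply: subset_leq_card.
apply/subsetP=> -[u v]; rewrite !inE /= => /and3P[uU vU ->]; rewrite andbT.
apply/forallP=> o; apply/implyP=> uvo; apply: US; rewrite inE.
by case: o uvo => // x /orP[]/eqP->.
Qed.

Lemma gain_ge_L (S : {set O}) : opening \subset S -> Key \in S -> L <= gain S.
Proof.
move=> /subsetP US KS; apply: leq_trans weight_Hub _.
rewrite /gain card_clique_partE; suff -> : inside S Hub by rewrite leq_addl.
by apply/forallP=> o; apply/implyP; case: o => //= _; apply: US; rewrite inE.
Qed.

Lemma clears_all : clears G m setT.
Proof.
suff cS S : clears G m (saturation (S :|: (Key |: opening))).
  apply: clearsS (cS setT); rewrite setTU; apply/subsetP=> x _; rewrite !inE.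
  by case: (cl x) => [o|q]; rewrite ?inE //= insideT.
elim/set_ind: S => [|o S _ cS]; rewrite ?set0U -?setUA.
  apply: (clears_saturationU1 adj_split); first by rewrite weight_Key gain_ge_c.
  exact/(clears_saturation adj_split)/clears_opening.
have [oK|oK] := eqVneq o Key.
  by rewrite (setUidPr _) // oK sub1set !inE eqxx orbT.
apply: (clears_saturationU1 adj_split) => //; rewrite weight_indep //.
apply: gain_ge_L; last by rewrite !inE eqxx orbT.
by rewrite setUA subsetUr.
Qed.

End Sufficiency.

Section Necessity.
Hypothesis few : forall U : {set V}, #|U| <= k -> #|edges_within E U| < c.

Definition admissible (S : {set O}) : Prop :=
  [/\ PointGate \in S -> EdgeGate \notin S /\ TwinGate \notin S,
      EdgeGate \in S -> TwinGate \in S -> Key \notin S /\ #|points S| <= k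
    & PointGate \in S -> Key \in S -> #|points S| < #|V| - k].

Lemma card_clique_part_le (P : pred Q) (A : {set V * V}) (B : {set V}) :
  (forall u v, P (EdgeOf u v) -> E u v -> (u, v) \in A) ->
  (forall v, P (PointOf v) -> v \in B) -> P Hub = false ->
  #|clique_part P| <= #|A| + a * #|B|.
Proof.
move=> PA PB PH; rewrite card_clique_partE PH addn0; apply: leq_add.
  by apply: subset_leq_card; apply/subsetP=> -[u v]; rewrite inE => /andP[/PA].
rewrite leq_mul2l subset_leq_card ?orbT //.
by apply/subsetP=> v; rewrite inE; apply: PB.
Qed.

Lemma clique_part_eq0 (P : pred Q) : 
  (forall u v, P (EdgeOf u v) = false) -> (forall v, P (PointOf v) = false) ->
  P Hub = false -> #|clique_part P| = 0.
Proof.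
move=> PE PP PH; apply: eq_card0 => x; rewrite !inE.
by case: (cl x) => // -[u v|v|].
Qed.

Lemma gain_point_gate S : admissible S -> PointGate \in S ->
  gain S <= if Key \in S then a * #|points S| else 0.
Proof.
case=> + _ _ => /[apply] -[S1 _].
have noEdge u v : inside S (EdgeOf u v) = false by apply: insideF S1.
have noHub : inside S Hub = false by apply: insideF S1.
case: ifP => [_|/negbT KS].
  rewrite -[_ * _]add0n -(@cards0 (V * V)%type).
  apply: card_clique_part_le => // [u v|v /mem_inside iv].
    by rewrite noEdge.
  by rewrite inE iv //= eqxx.
by rewrite /gain clique_part_eq0 // => v; apply: insideF KS.
Qed.

Lemma gain_edge_gates S : admissible S -> PointGate \notin S ->
  gain S <= if (EdgeGate \in S) && (TwinGate \in S)
            then #|edges_within E (points S)| else 0.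
Proof.
case=> _ adm2 _ PS.
have noPoint v : inside S (PointOf v) = false by apply: insideF PS.
have noHub : inside S Hub = false.
  apply/negP=> /mem_inside iH;
    have [] := adm2 (iH EdgeGate isT) (iH TwinGate isT).
  by rewrite iH.
case: ifP => [_|/negbT].
  rewrite -[#|edges_within _ _|]addn0 -[X in _ + X](muln0 a) -(@cards0 V).
  apply: card_clique_part_le => // [u v /mem_inside iuv uv|v].
    by rewrite !inE uv !iuv //= eqxx ?orbT.
  by rewrite noPoint.
rewrite negb_and => oS; rewrite /gain clique_part_eq0 // => u v.
by case/orP: oS; apply: insideF.
Qed.

Lemma gain_lt_c S : admissible S -> PointGate \notin S -> gain S < c.
Proof.
move=> adm PS; apply: leq_ltn_trans (gain_edge_gates adm PS) _.
case: ifP => // /andP[S1 S2]; case: adm => _ /(_ S1 S2)[_ Sk] _; exact: few.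
Qed.

Lemma mul_addn_le_L n : n < #|V| - k -> a * n + a <= L.
Proof. by move=> nV; rewrite -mulnSr LE leq_mul2l nV orbT. Qed.

Lemma gain_add_le_L S : admissible S -> PointGate \in S -> gain S + a <= L.
Proof.
move=> adm PS; have := gain_point_gate adm PS; case: ifP => [KS gS|_].
  have Sk : #|points S| < #|V| - k by case: adm => _ _; apply.
  by apply: leq_trans (mul_addn_le_L Sk); rewrite leq_add2r.
rewrite leqn0 => /eqP->; have := @mul_addn_le_L 0.
by rewrite muln0 subn_gt0; apply.
Qed.

Lemma weight_indep_ge o : c <= wt (inl o).
Proof.
by have [->|/weight_indep->] := eqVneq o Key; rewrite ?weight_Key //; lia.
Qed.

Lemma gain_lt S o : admissible S -> o \notin S -> gain S < wt (inl o).
Proof.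
move=> adm oS; have [PS|PS] := boolP (PointGate \in S); last first.
  exact: leq_trans (gain_lt_c adm PS) (weight_indep_ge o).
have [oK|/weight_indep->] := eqVneq o Key; last first.
  by have := gain_add_le_L adm PS; lia.
apply: leq_trans (weight_indep_ge o).
by apply: leq_ltn_trans (gain_point_gate adm PS) _; rewrite -oK (negPf oS).
Qed.

Lemma slack_gates (S : {set O}) :
  PointGate \in S -> (EdgeGate \in S) || (TwinGate \in S) ->
  slack S = 0.
Proof.
move=> PS gS; apply: clique_part_eq0 => [u v|v|].
- by case/orP: gS; apply: outsideF.
- exact: outsideF PS.
- by case/orP: gS; apply: outsideF.
Qed.

Lemma slack_EdgeGate_Key (S : {set O}) : EdgeGate \in S -> Key \in S ->
  slack S = 0.
Proof.
move=> gS KS; apply: clique_part_eq0 => [u v|v|]; first exact: outsideF gS.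
  exact: outsideF KS.
exact: outsideF gS.
Qed.

Lemma slack_EdgeGate (S : {set O}) : EdgeGate \in S ->
  slack S <= a * (#|V| - #|points S|).
Proof.
move=> gS; have -> : #|V| - #|points S| = #|~: points S|.
  by rewrite [RHS]cardsCs setCK.
rewrite -[_ * _]add0n -(@cards0 (V * V)%type).
apply: card_clique_part_le => [u v|v /notin_outside ov|].
- by rewrite (outsideF _ gS).
- by rewrite !inE ov //= eqxx.
- exact: outsideF gS.
Qed.

Lemma slack_PointGate (S : {set O}) : PointGate \in S -> Key \in S ->
  slack S <= #|edges_within E (~: points S)|.
Proof.
move=> PS KS.
rewrite -[#|edges_within _ _|]addn0 -[X in _ + X](muln0 a) -(@cards0 V).
apply: card_clique_part_le => [u v /notin_outside ouv uv|v|].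
- by rewrite !inE uv !ouv //= eqxx ?orbT.
- by rewrite (outsideF _ PS).
- exact: outsideF KS.
Qed.

Section AdmissibleStep.
Variables S S' : {set O}.
Hypotheses (adm : admissible S) (newS : ~~ (S' \subset S)).
Hypothesis cost : #|indep_part cl (S' :\: S)| <= slack S' + gain S.

Lemma weight_new_le o : o \in S' -> o \notin S ->
  wt (inl o) <= slack S' + gain S.
Proof.
by move=> oS' oS; apply: leq_trans cost; apply: weight_le_indep_part;
  rewrite inE oS.
Qed.

Lemma slack_step_neq0 : slack S' <> 0.
Proof.
have [o oS' oS] := subsetPn newS => s0; have := weight_new_le oS' oS.
by rewrite s0 leqNgt gain_lt.
Qed.

Lemma new_point_le : #|points S| < #|points S'| -> L <= slack S' + gain S.
Proof.
move=> lt; have /subsetPn[v] : ~~ (points S' \subset points S).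
  by apply: contraL lt => /subset_leq_card; rewrite -leqNgt.
by rewrite !inE -(@weight_indep (Point v)) //; apply: weight_new_le.
Qed.

Lemma gates_exclusive_step :
  PointGate \in S' -> EdgeGate \notin S' /\ TwinGate \notin S'.
Proof.
move=> PS'; apply/andP; rewrite -negb_or; apply/negP=> gS'.
exact/slack_step_neq0/slack_gates.
Qed.

Lemma edge_gates_step :
  EdgeGate \in S' -> TwinGate \in S' -> Key \notin S' /\ #|points S'| <= k.
Proof.
move=> eS' tS'; split.
  by apply/negP=> KS'; apply/slack_step_neq0/slack_EdgeGate_Key.
rewrite leqNgt; apply/negP=> kS'.
have slackL : slack S' + a <= L.
  apply: leq_trans (mul_addn_le_L (n := #|V| - k.+1) _); last lia.
  rewrite leq_add2r; apply: leq_trans (slack_EdgeGate eS') _.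
  by rewrite leq_mul2l leq_sub2l ?orbT.
have [PS|PS] := boolP (PointGate \in S).
  have [eS tS] : EdgeGate \notin S /\ TwinGate \notin S by case: adm => /(_ PS).
  have := @weight2_le_indep_part _ _ _ cl (S' :\: S) EdgeGate TwinGate.
  rewrite !inE eS tS eS' tS' !weight_indep // => /(_ isT isT isT).
  have := gain_add_le_L adm PS; move: cost; lia.
suff : L <= slack S' + gain S by have := gain_lt_c adm PS; lia.
have [eS|eS] := boolP (EdgeGate \in S); last first.
  by rewrite -(@weight_indep EdgeGate) ?weight_new_le.
have [tS|tS] := boolP (TwinGate \in S); last first.
  by rewrite -(@weight_indep TwinGate) ?weight_new_le.
by apply: new_point_le; apply: leq_ltn_trans kS'; case: adm => _ /(_ eS tS)[].
Qed.

Lemma key_step : PointGate \in S' -> Key \in S' -> #|points S'| < #|V| - k.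
Proof.
move=> PS' KS'; rewrite ltnNge; apply/negP=> kS'.
have slack_lt : slack S' < c.
  apply: leq_ltn_trans (slack_PointGate PS' KS') _; apply: few.
  by rewrite cardsCs setCK; lia.
have [PS|PS] := boolP (PointGate \in S); last first.
  have := gain_lt_c adm PS; have := weight_new_le PS' PS.
  by rewrite weight_indep //; lia.
have [KS|KS] := boolP (Key \in S).
  have /new_point_le : #|points S| < #|points S'|.
    by apply: leq_trans kS'; case: adm => _ _; apply.
  by have := gain_add_le_L adm PS; lia.
have := gain_point_gate adm PS; rewrite (negPf KS).
by have := weight_new_le KS' KS; rewrite weight_Key; lia.
Qed.

Lemma admissible_step : admissible S'.
Proof.
by split;
  [exact: gates_exclusive_step | exact: edge_gates_step | exact: key_step].
Qed.

End AdmissibleStep.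

Lemma not_clears_all : ~ clears G m setT.
Proof.
case=> F [sF]; rewrite subTset => /eqP clF.
pose P (C : {set X}) := exists2 S, admissible S & C \subset saturation S.
have [S adm] : P (~: burning G F (size F)).
  apply: setC_burning_ind sF _ _.
    by exists set0; rewrite ?sub0set //; split; rewrite inE.
  move=> C A [S adm CS] Am.
  have [T YT [TE|[nTS cost]]] :=
    saturation_step adj_split CS Am (fun o => gain_lt adm).
    by rewrite TE in YT; exists S.
  by exists T => //; apply: admissible_step adm nTS cost.
rewrite clF => /subsetP allS; have inS o : o \in S.
  have /card_gt0P[x] : 0 < wt (inl o) by apply: leq_trans (weight_indep_ge o).
  rewrite inE => /eqP xo; have := allS x (in_setT _).
  by rewrite !inE xo orbF.
by case: adm => /(_ (inS _))[]; rewrite inS.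
Qed.

End Necessity.

Theorem winnable_gadget :
  winnable G m <-> exists2 U : {set V}, #|U| <= k & c <= #|edges_within E U|.
Proof.
rewrite winnable_clears; last first.
  have := card_clique_partE predT; move: weight_Hub => /=; lia.
split=> [win|[U Uk cU]]; last exact: clears_all Uk cU.
apply: contrapT => noU; apply: not_clears_all win => U Uk.
by rewrite ltnNge; apply/negP => cU; apply: noU; exists U.
Qed.

End Gadget.

(** * Accepting runs as cliques of events *)

Definition cell A (x : tape A) (k : int) : sym A :=
  let: (l, a, r) := x in
  match k with
  | Posz 0 => a
  | Posz k'.+1 => nth None r k'
  | Negz k' => nth None l k'
  end.

Definition shift (d : move) : int :=
  match d with MoveL => (-1)%R | MoveS => 0%R | MoveR => 1%R end.

Lemma cell_write_move A (y : sym A * move) (x : tape A) (k : int) :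
  cell (write_move y x) k =
  if (k + shift y.2 == 0)%R then y.1 else cell x (k + shift y.2)%R.
Proof.
case: y x => b [] [[l a] r] /=.
- by case: k => [[|[|k]]|k] /=; rewrite ?nth_behead ?addn0 //; case: l.
- by rewrite GRing.addr0; case: k => [[|k]|k].
- by case: k => [[|k]|[|k]] /=; rewrite ?nth_behead ?addn1 ?subn1.
Qed.

Lemma cell_input_tape A (w : seq bool) (k : int) :
  cell (input_tape A w) k =
  if k is Posz k' then nth None [seq Some (inl b) | b <- w] k' else None.
Proof.
rewrite /input_tape; case: k => [[|k]|k] /=; rewrite ?nth0 ?nth_behead //.
by rewrite nth_nil.
Qed.

Section HeadHistory.
Variables (T : Type) (ini wr : nat -> T) (pos : nat -> nat).

Fixpoint content t p :=
  if t is t'.+1 then if p == pos t' then wr t' else content t' p else ini p.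

Lemma content_unvisited l t p :
  l <= t -> (forall s, l <= s < t -> pos s != p) -> content t p = content l p.
Proof.
elim: t => [|t IHt]; first by rewrite leqn0 => /eqP->.
rewrite leq_eqVlt => /orP[/eqP<-//|lt] unvisited /=.
rewrite eq_sym (negPf (unvisited t _)) ?ltnSn ?andbT //.
by apply: IHt => // s /andP[ls st]; apply: unvisited; rewrite ls ltnW.
Qed.

Lemma content_last l t :
  l <= t -> (forall s, l <= s < t -> pos s != pos t) ->
  (forall s, l = s.+1 -> pos s = pos t) ->
  content t (pos t) = if l is s.+1 then wr s else ini (pos t).
Proof.
move=> lt unvisited visit; rewrite (content_unvisited lt unvisited).
by case: l {lt unvisited} visit => //= s ->; rewrite ?eqxx.
Qed.

(* 0 if the cell under the head at time t is visited for the first time, and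
   s.+1 if its previous visit was at time s. *)
Definition last_visit t := \max_(s < t | pos s == pos t) s.+1.

Lemma last_visit_le t : last_visit t <= t.
Proof. by apply/bigmax_leqP=> -[s st]. Qed.

Lemma last_visit_max s t : last_visit t <= s < t -> pos s != pos t.
Proof.
case/andP=> ls st; apply: contraTneq ls => pst; rewrite -ltnNge.
apply: (@leq_bigmax_cond _ _ (fun j : 'I_t => j.+1) (Ordinal st)).
by rewrite /= pst.
Qed.

Lemma pos_last_visit s t : last_visit t = s.+1 -> pos s = pos t.
Proof.
rewrite /last_visit; elim/big_ind: _ => [//|x y IHx IHy|s' /eqP + [<-]//].
by rewrite /maxn; case: ifP.
Qed.

Lemma content_last_visit t :
  content t (pos t) = if last_visit t is s.+1 then wr s else ini (pos t).
Proof.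
apply: content_last; first exact: last_visit_le.
  by move=> s; apply: last_visit_max.
by move=> s; apply: pos_last_visit.
Qed.

End HeadHistory.

Section Snapshots.
Variable M : TM.
Local Notation tp := 'I_(extra M).+1.
Local Notation symbol := (sym (aux M)).

(* The state and the symbols read, followed by the transition taken. *)
Definition snapshot :=
  ((state M * {ffun tp -> symbol}) *
   (state M * {ffun tp -> symbol * move}))%type.
HB.instance Definition _ := Finite.on snapshot.

Implicit Types z : snapshot.
Definition snap_state z := z.1.1.
Definition snap_read z := z.1.2.
Definition snap_next z := z.2.1.
Definition snap_write z (i : tp) := (z.2.2 i).1.
Definition snap_move z (i : tp) := (z.2.2 i).2.

Definition stall q (r : {ffun tp -> symbol}) : snapshot :=
  ((q, r), (q, [ffun i => (r i, MoveS)])).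

Definition halting z := trans (snap_state z) (snap_read z) == set0.

(* A halted machine is continued by stalling, so that all runs can be given the
   same length. *)
Definition legal z := (z.2 \in trans (snap_state z) (snap_read z)) ||
  (halting z && (z == stall (snap_state z) (snap_read z))).

Definition accepting_halt z := halting z && (snap_state z \in accepting M).

Definition moved (d : move) (p p' : nat) : bool :=
  match d with MoveL => p == p'.+1 | MoveS => p' == p | MoveR => p' == p.+1 end.

Definition fire (c : config M) z : config M :=
  (snap_next z, [ffun i => write_move (z.2.2 i) (c.2 i)]).

Definition reads (c : config M) : {ffun tp -> symbol} :=
  [ffun i => (c.2 i).1.2].

Lemma fire_stall c : fire c (stall c.1 (reads c)) = c.
Proof.
case: c => q x; rewrite /fire /=; congr (_, _); apply/ffunP=> i.
by rewrite !ffunE /=; case: (x i) => [[l a] r].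
Qed.

Lemma legal_stall c : halted c -> legal (stall c.1 (reads c)).
Proof.
by move=> hc; rewrite /legal eqxx andbT; apply/orP; right; apply/eqP.
Qed.

End Snapshots.

Lemma steps_trans (M : TM) n n' (c d e : config M) :
  steps n c d -> steps n' d e -> steps (n + n') c e.
Proof.
elim: n c => [c -> //|n IHn c [c' cc' cd] de].
by exists c' => //; apply: IHn.
Qed.

Lemma steps1 (M : TM) (c d : config M) : step c d -> steps 1 c d.
Proof. by move=> cd; exists d. Qed.

Section Events.
Variables (M : TM) (origin stop horizon : nat) (bits : seq bool).
Local Notation tp := 'I_(extra M).+1.

Definition initial_cell (i : tp) (p : nat) : sym (aux M) :=
  if [&& i == ord0, origin <= p & p < stop]
  then Some (inl (nth false bits p)) else None.

Record event := Event {
  snap : snapshot M;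
  time : nat;
  pos : tp -> nat;
  last : tp -> nat
}.

Definition valid (e : event) : bool :=
  [&& legal (snap e),
      (time e == 0) ==>
        (snap_state (snap e) == start M) && [forall i, pos e i == origin],
      ((time e).+1 == horizon) ==> accepting_halt (snap e)
    & [forall i, (last e i <= time e) && ((last e i == 0) ==>
        (snap_read (snap e) i == initial_cell i (pos e i)))]].

Definition compatible (e e' : event) : bool :=
  [forall i,
    [&& (last e' i == (time e).+1) ==>
          (pos e i == pos e' i) &&
          (snap_write (snap e) i == snap_read (snap e') i),
        (last e' i <= time e) ==> (pos e i != pos e' i)
      & (time e' == (time e).+1) ==>
          moved (snap_move (snap e) i) (pos e i) (pos e' i)]]
  && ((time e' == (time e).+1) ==>
        (snap_next (snap e) == snap_state (snap e'))).

Definition consistent (ev : nat -> event) : Prop :=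
  (forall t, t < horizon -> time (ev t) = t /\ valid (ev t)) /\
  (forall s t, s < t < horizon -> compatible (ev s) (ev t)).

End Events.

Section Located.
Variables (M : TM) (origin : nat) (w : seq bool).
Local Notation tp := 'I_(extra M).+1.
Local Notation stop := (origin + size w).
Local Notation bits := (nseq origin false ++ w).
Local Notation ini := (@initial_cell M origin stop bits).
Variables (zt : nat -> snapshot M) (pos : nat -> tp -> nat).

Definition tape_content (i : tp) :=
  content (ini i) (fun t => snap_write (zt t) i) (pos^~ i).

Definition located (c : config M) t :=
  forall i p, cell (c.2 i) (Posz p - Posz (pos t i))%R = tape_content i t p.

Lemma located_init : (forall i, pos 0 i = origin) -> located (init M w) 0.
Proof.
move=> pos0 i p.
rewrite ffunE pos0 cell_input_tape /= /initial_cell nth_cat size_nseq.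
have [op|po] := leqP origin p; last first.
  by rewrite andbF; case kE: (Posz p - Posz origin)%R => //; lia.
have -> : (Posz p - Posz origin = Posz (p - origin))%R by lia.
case: (i == ord0) => /=; last by rewrite nth_nil.
have [ps|sp] := ltnP p stop; first by rewrite (nth_map false) //; lia.
by rewrite nth_default // size_map; lia.
Qed.

Lemma located_fire c t :
  located c t ->
  (forall i, moved (snap_move (zt t) i) (pos t i) (pos t.+1 i)) ->
  located (fire c (zt t)) t.+1.
Proof.
move=> loc mv i p; rewrite /fire /= ffunE cell_write_move.
have -> : (Posz p - Posz (pos t.+1 i) + shift ((zt t).2.2 i).2 =
           Posz p - Posz (pos t i))%R.
  by have := mv i; rewrite /snap_move; case: (_.2) => /= /eqP; lia.
rewrite loc; have -> : (Posz p - Posz (pos t i) == 0)%R = (p == pos t i) by lia.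
by [].
Qed.

Lemma located_reads c t i : located c t ->
  reads c i = tape_content i t (pos t i).
Proof.
by move=> loc; rewrite -loc GRing.subrr ffunE; case: (c.2 i) => [[l a] r].
Qed.

End Located.

Section Soundness.
Variables (M : TM) (w : seq bool) (origin horizon : nat) (ev : nat -> event M).
Local Notation tp := 'I_(extra M).+1.
Local Notation stop := (origin + size w).
Local Notation bits := (nseq origin false ++ w).
Local Notation snapt := (fun t => snap (ev t)).
Local Notation post := (fun t => pos (ev t)).
Hypothesis con : consistent origin stop horizon bits ev.

Lemma read_content t i :
  t < horizon ->
  snap_read (snap (ev t)) i
    = tape_content origin w snapt post i t (pos (ev t) i).
Proof.
case: con => val com tH; have [tE /and4P[_ _ _ /forallP/(_ i)]] := val t tH.
rewrite tE => /andP[lt l0].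
rewrite /tape_content (@content_last _ _ _ _ (last (ev t) i)) //=.
- case lE: (last (ev t) i) lt l0 => [|s] st; first by move/eqP.
  have /andP[/forallP/(_ i)/and3P[+ _ _] _] :=
    com s t (introT andP (conj st tH)).
  by have [-> _] := val s (ltn_trans st tH); rewrite lE eqxx => /andP[_ /eqP].
- move=> s /andP[ls st].
  have /andP[/forallP/(_ i)/and3P[_ + _] _] :=
    com s t (introT andP (conj st tH)).
  by have [-> _] := val s (ltn_trans st tH); rewrite ls.
- move=> s lE; have st : s < t by rewrite -lE.
  have /andP[/forallP/(_ i)/and3P[+ _ _] _] :=
    com s t (introT andP (conj st tH)).
  by have [-> _] := val s (ltn_trans st tH); rewrite lE eqxx => /andP[/eqP].
Qed.

Lemma reads_located c t :
  t < horizon -> located origin w snapt post c t ->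
  reads c = snap_read (snap (ev t)).
Proof.
by move=> tH loc; apply/ffunP=> i; rewrite (located_reads _ loc) read_content.
Qed.

Lemma consecutive_events t :
  t.+1 < horizon ->
  snap_next (snap (ev t)) = snap_state (snap (ev t.+1)) /\
  forall i, moved (snap_move (snap (ev t)) i) (pos (ev t) i) (pos (ev t.+1) i).
Proof.
case: con => val com tH; have [tE _] := val t (ltnW tH).
have [tE' _] := val _ tH.
have /andP[/forallP mv] := com t t.+1 (introT andP (conj (ltnSn t) tH)).
rewrite tE tE' eqxx => /eqP nextE; split=> // i.
by have /and3P[_ _] := mv i; rewrite tE tE' eqxx.
Qed.

Lemma events_reachable t :
  t < horizon -> exists n c, [/\ steps n (init M w) c,
    c.1 = snap_state (snap (ev t)) & located origin w snapt post c t].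
Proof.
elim: t => [|t IHt] tH.
  case: con => val _; have [tE /and4P[_ + _ _]] := val 0 tH.
  rewrite tE => /andP[/eqP st0 /forallP pos0].
  exists 0, (init M w); split=> //; apply: located_init => i; exact/eqP.
have [n [c [run cE loc]]] := IHt (ltnW tH).
have [nextE mv] := consecutive_events tH.
have rE := reads_located (ltnW tH) loc; have loc' := located_fire loc mv.
case: con => val _.
have [_ /and4P[/orP[tr|/andP[_ /eqP zE]] _ _ _]] := val t (ltnW tH).
  exists (n + 1), (fire c (snap (ev t))); split=> //.
  by apply/(steps_trans run)/steps1; exists (snap (ev t)).2;
    rewrite // /options -/(reads c) rE cE.
by exists n, c; rewrite -nextE zE cE; split=> //;
  rewrite -(fire_stall c) rE cE -zE.
Qed.

Lemma consistent_accepts : 0 < horizon -> accepts M w.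
Proof.
move=> H0; have lastH : horizon.-1 < horizon by rewrite ltn_predL.
have [n [c [run cE loc]]] := events_reachable lastH; exists n, c.
case: con => val _; have [tE /and4P[_ _ + _]] := val _ lastH.
rewrite tE prednK // eqxx => /andP[/eqP halt acc]; split; rewrite ?cE //.
by rewrite /halted /options -/(reads c) (reads_located lastH loc) cE.
Qed.

End Soundness.

Section Completeness.
Variables (M : TM) (w : seq bool).
Local Notation tp := 'I_(extra M).+1.

Lemma run_snapshots n (c0 c : config M) :
  steps n c0 c -> halted c ->
  exists (cf : nat -> config M) (zf : nat -> snapshot M), [/\ cf 0 = c0,
    forall t, [/\ snap_state (zf t) = (cf t).1, snap_read (zf t) = reads (cf t),
                  legal (zf t) & cf t.+1 = fire (cf t) (zf t)]
    & forall t, n <= t -> zf t = stall c.1 (reads c)].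
Proof.
move=> + hc; elim: n c0 => [|n IHn] c0 /=.
  move=> ->; exists (fun=> c), (fun=> stall c.1 (reads c)); split=> // t.
  by split=> //; [exact: legal_stall | rewrite fire_stall].
case=> d [a ac dE] /IHn [cf [zf [cf0 cfS zf_stall]]].
exists (fun t => if t is t'.+1 then cf t' else c0),
  (fun t => if t is t'.+1 then zf t' else ((c0.1, reads c0), a)).
split=> // [[|t]|[|t]] //=; last by rewrite ltnS; apply: zf_stall.
by split=> //; rewrite ?cf0 ?dE // /legal -/(options c0) ac.
Qed.

Variables (n origin : nat) (c : config M).
Variables (cf : nat -> config M) (zf : nat -> snapshot M).
Hypothesis n_origin : n <= origin.
Hypothesis zf_stall : forall t, n <= t -> zf t = stall c.1 (reads c).

Fixpoint head_pos t (i : tp) : nat :=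
  if t is t'.+1 then
    match snap_move (zf t') i with
    | MoveL => (head_pos t' i).-1
    | MoveS => head_pos t' i
    | MoveR => (head_pos t' i).+1
    end
  else origin.

Lemma snap_move_stall t i : n <= t -> snap_move (zf t) i = MoveS.
Proof. by move/zf_stall->; rewrite /snap_move ffunE. Qed.

Lemma head_pos_bounds t i :
  origin - minn t n <= head_pos t i <= origin + minn t n.
Proof.
elim: t => [|t IHt] /=; first by rewrite min0n subn0 addn0 leqnn.
have [tn|/snap_move_stall->] := ltnP t n; last by move: IHt; lia.
by move: IHt; case: (snap_move _ _); lia.
Qed.

Lemma head_pos_moved t i :
  moved (snap_move (zf t) i) (head_pos t i) (head_pos t.+1 i).
Proof.
rewrite /=; case mE: (snap_move _ _) => //=; have := head_pos_bounds t i.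
have : t < n by rewrite ltnNge; apply/negP=> /(snap_move_stall i); rewrite mE.
lia.
Qed.

Variable horizon : nat.
Hypotheses (n_horizon : n < horizon).
Hypotheses (halt : halted c) (acc : c.1 \in accepting M).
Hypothesis cf0 : cf 0 = init M w.
Hypothesis cfS : forall t,
  [/\ snap_state (zf t) = (cf t).1, snap_read (zf t) = reads (cf t),
      legal (zf t) & cf t.+1 = fire (cf t) (zf t)].
Local Notation stop := (origin + size w).
Local Notation bits := (nseq origin false ++ w).

Definition run_event t : event M :=
  Event (zf t) t (head_pos t) (fun i => last_visit (head_pos^~ i) t).

Lemma run_located t : located origin w zf head_pos (cf t) t.
Proof.
elim: t => [|t IHt]; first by rewrite cf0; apply: located_init.
by have [_ _ _ ->] := cfS t; apply: located_fire IHt (head_pos_moved t).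
Qed.

Lemma run_read t i :
  snap_read (zf t) i =
  if last_visit (head_pos^~ i) t is s.+1 then snap_write (zf s) i
  else initial_cell origin stop bits i (head_pos t i).
Proof.
have [_ -> _ _] := cfS t; rewrite (located_reads _ (run_located t)).
exact: content_last_visit.
Qed.

Lemma run_consistent : consistent origin stop horizon bits run_event.
Proof.
split=> [t tH|s t /andP[st tH]].
  split=> //; have [sE _ lg _] := cfS t; apply/and4P; split=> //=.
  - by apply/implyP=> /eqP t0; rewrite sE t0 cf0 eqxx; apply/forallP=> i /=.
  - apply/implyP=> /eqP tE; rewrite zf_stall; last by lia.
    by rewrite /accepting_halt acc andbT; apply/eqP.
  - apply/forallP=> i; rewrite last_visit_le; apply/implyP=> /eqP l0.
    by rewrite run_read l0.
apply/andP; split; last first.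
  apply/implyP=> /eqP /= tE; have [_ _ _ cE] := cfS s.
  by have [-> _ _ _] := cfS t; rewrite tE cE.
apply/forallP=> i; apply/and3P; split; apply/implyP=> /=.
- by move/eqP=> lE; rewrite run_read lE (pos_last_visit lE) !eqxx.
- by move=> ls; apply: (last_visit_max (pos := head_pos^~ i)); rewrite ls.
- by move/eqP->; apply: head_pos_moved.
Qed.

End Completeness.

Lemma accepts_consistent (M : TM) (w : seq bool) T origin horizon :
  accepts M w -> (forall n c, steps n (init M w) c -> n <= T) ->
  T <= origin -> T < horizon ->
  exists2 ev : nat -> event M,
    consistent origin (origin + size w) horizon (nseq origin false ++ w) ev &
    forall t i, pos (ev t) i <= origin + T.
Proof.
case=> n [c [run halt acc]] /(_ _ _ run) nT To TH.
have [cf [zf [cf0 cfS zf_stall]]] := run_snapshots run halt.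
have no := leq_trans nT To; exists (run_event origin zf).
  exact: (run_consistent no zf_stall (leq_ltn_trans nT TH) halt acc cf0 cfS).
by move=> t i; have := head_pos_bounds no zf_stall t i => /=; lia.
Qed.

Definition agree J (f f' : nat -> nat) := [forall k : 'I_J, f k == f' k].

Lemma agree_refl J f : agree J f f.
Proof. exact/forallP. Qed.

Lemma agree_sym J f f' : agree J f f' = agree J f' f.
Proof. by apply: eq_forallb => k; rewrite eq_sym. Qed.

Definition coords J B (v : {ffun 'I_J -> 'I_B}) (k : nat) : nat :=
  if insub k is Some i then v i else 0.

Lemma coords_ord J B (v : {ffun 'I_J -> 'I_B}) (i : 'I_J) : coords v i = v i.
Proof. by rewrite /coords valK. Qed.

Lemma agree_coords J B (v v' : {ffun 'I_J -> 'I_B}) :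
  agree J (coords v) (coords v') = (v == v').
Proof.
apply/forallP/eqP => [vv'|-> //]; apply/ffunP=> i; apply: val_inj.
by have := vv' i; rewrite !coords_ord => /eqP.
Qed.

Section EventGraph.
Variable M : TM.
Local Notation K := (extra M).+1.

(* An event is stored as its time, its snapshot, and for every head the position
   and the last visit. *)
Definition ncoord := (K + K).+2.
Definition pos_coord (i : 'I_K) : nat := i.+2.
Definition last_coord (i : 'I_K) : nat := (K + i).+2.

Definition event_at (z : snapshot M) (f : nat -> nat) : event M :=
  Event z (f 0) (f \o pos_coord) (f \o last_coord).

Definition event_coords (e : event M) (k : nat) : nat :=
  match k with
  | 0 => time e
  | 1 => enum_rank (snap e)
  | k'.+2 => if k' < K then pos e (inord k') else last e (inord (k' - K))
  end.

Lemma event_coordsK e : event_at (snap e) (event_coords e) = e.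
Proof.
case: e => z t p l; congr Event; apply/funext => i /=.
  by rewrite ltn_ord inord_val.
by rewrite ltnNge leq_addr addKn inord_val.
Qed.

Lemma eq_event_at z f f' :
  (forall k, k < ncoord -> f k = f' k) -> event_at z f = event_at z f'.
Proof.
move=> ff'; rewrite /event_at ff' //; congr Event; apply/funext => i /=;
  apply: ff';
  by have := ltn_ord i; rewrite /ncoord /pos_coord /last_coord; lia.
Qed.

Section Compatibility.
Variables (origin stop side : nat) (bits : seq bool).

Definition ordered_compatible (e e' : event M) :=
  (time e < time e') && compatible e e'.

Definition event_rel (f f' : nat -> nat) : bool :=
  [exists z : snapshot M, exists z' : snapshot M,
    [&& f 1 == enum_rank z, f' 1 == enum_rank z',
        valid origin stop side bits (event_at z f),
        valid origin stop side bits (event_at z' f')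
      & [|| agree ncoord f f',
            ordered_compatible (event_at z f) (event_at z' f')
          | ordered_compatible (event_at z' f') (event_at z f)]]].

Lemma eq_event_rel f f' g g' :
  (forall k, k < ncoord -> f k = g k) ->
  (forall k, k < ncoord -> f' k = g' k) ->
  event_rel f f' = event_rel g g'.
Proof.
move=> fg f'g'; apply: eq_existsb => z; apply: eq_existsb => z'.
rewrite fg // f'g' // (eq_event_at z fg) (eq_event_at z' f'g').
by congr [&& _, _, _, _ & _ || _]; apply: eq_forallb => k; rewrite fg ?f'g'.
Qed.

Definition event_edge : rel {ffun 'I_ncoord -> 'I_side} :=
  fun u v => event_rel (coords u) (coords v).

End Compatibility.
End EventGraph.

Lemma inj_card_in_onto (T T' : finType) (f : T -> T') (A : {set T}) :
  {in A &, injective f} -> #|A| = #|T'| ->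
  forall y, exists2 x, x \in A & f x = y.
Proof.
move=> inj_f cA y; have : y \in f @: A; last by case/imsetP=> x xA ->; exists x.
suff /eqP-> : f @: A == setT by rewrite inE.
by rewrite eqEcard subsetT cardsT card_in_imset // cA leqnn.
Qed.

Section EventCliques.
Variables (M : TM) (w : seq bool) (T origin side : nat).
Local Notation stop := (origin + size w).
Local Notation bits := (nseq origin false ++ w).
Local Notation V := {ffun 'I_(ncoord M) -> 'I_side}.
Local Notation edge := (@event_edge M origin stop side bits).

Section FromRun.
Hypothesis os : origin + T < side.
Hypothesis snapshots_side : #|{: snapshot M}| <= side.
Variable ev : nat -> event M.
Hypothesis con : consistent origin stop side bits ev.
Hypothesis pos_le : forall t i, pos (ev t) i <= origin + T.

Definition event_vertex (t : 'I_side) : V :=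
  [ffun k : 'I_(ncoord M) => insubd t (event_coords (ev t) k)].

Lemma event_coords_lt (t : 'I_side) k : event_coords (ev t) k < side.
Proof.
case: con => val _.
have [tE /and4P[_ _ _ /forallP le_last]] := val t (ltn_ord t).
case: k => [|[|k]] /=; first by rewrite tE.
  exact: leq_trans (ltn_ord _) snapshots_side.
case: ifP => _; first exact: leq_ltn_trans (pos_le _ _) os.
by have /andP[le _] := le_last (inord (k - (extra M).+1));
  rewrite (leq_ltn_trans le) ?tE.
Qed.

Lemma coords_event_vertex t k :
  k < ncoord M -> coords (event_vertex t) k = event_coords (ev t) k.
Proof.
move=> kJ; rewrite -[k]/(val (Ordinal kJ)) coords_ord ffunE insubdK //.
exact: event_coords_lt.
Qed.

Lemma event_at_vertex (t : 'I_side) :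
  event_at (snap (ev t)) (coords (event_vertex t)) = ev t.
Proof.
rewrite -[RHS]event_coordsK; apply: eq_event_at => k;
  exact: coords_event_vertex.
Qed.

Lemma event_edge_vertex (s t : 'I_side) :
  edge (event_vertex s) (event_vertex t).
Proof.
case: con => val com; have [sE vs] := val s (ltn_ord s).
have [tE vt] := val t (ltn_ord t).
apply/existsP; exists (snap (ev s)); apply/existsP; exists (snap (ev t)).
rewrite !coords_event_vertex //= !eqxx !event_at_vertex vs vt agree_coords /=.
rewrite /ordered_compatible sE tE.
case: (ltngtP s t) => [st|ts|/val_inj->]; last by rewrite eqxx.
  by rewrite (com s t) ?orbT // st ltn_ord.
by rewrite (com t s) ?orbT // ts ltn_ord.
Qed.

Lemma event_vertex_inj : injective event_vertex.
Proof.
case: con => val _ s t st; apply: val_inj.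
have [sE _] := val s (ltn_ord s); have [tE _] := val t (ltn_ord t).
by rewrite /= -sE -tE -(event_at_vertex s) -(event_at_vertex t) /= st.
Qed.

End FromRun.

Lemma accepts_clique :
  (forall n c, steps n (init M w) c -> n <= T) -> T <= origin ->
  origin + T < side ->
  #|{: snapshot M}| <= side -> accepts M w ->
  exists2 U : {set V}, #|U| <= side & side * side <= #|edges_within edge U|.
Proof.
move=> time_le To os ss acc; have Ts := leq_ltn_trans (leq_addl origin T) os.
have [ev con pos_le] := accepts_consistent acc time_le To Ts.
have cU : #|event_vertex ev @: setT| = side.
  by rewrite card_imset ?cardsT ?card_ord //;
    exact: event_vertex_inj con pos_le.
exists (event_vertex ev @: setT); first by rewrite cU.
rewrite card_edges_within_clique ?cU //.
by move=> u v /imsetP[s _ ->] /imsetP[t _ ->]; apply: event_edge_vertex.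
Qed.

Lemma eq_edge_time (U : {set V}) :
  {in U &, forall u v, edge u v} -> {in U &, injective (fun v : V => v ord0)}.
Proof.
move=> edgeU u v uU vU uv0; have := edgeU u v uU vU.
case/existsP=> z /existsP[z' /and5P[_ _ _ _]].
rewrite agree_coords /ordered_compatible /= !(coords_ord _ ord0) uv0 ltnn /=.
by rewrite orbF => /eqP.
Qed.

Lemma clique_vertex_at (U : {set V}) :
  #|U| = side -> {in U &, forall u v, edge u v} ->
  exists2 vertex : 'I_side -> V,
    forall t, vertex t \in U & forall t, vertex t ord0 = t.
Proof.
move=> cU edgeU; apply: (@fin_all_exists2 _ (fun=> V)
  (fun _ v => v \in U) (fun t v => v ord0 = t)) => t.
by apply: inj_card_in_onto (eq_edge_time edgeU) _ t; rewrite cU card_ord.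
Qed.

Lemma clique_events (U : {set V}) :
  #|U| = side -> {in U &, forall u v, edge u v} ->
  exists ev : 'I_side -> event M, forall t,
    [/\ time (ev t) = t, valid origin stop side bits (ev t)
      & forall s : 'I_side, s < t -> compatible (ev s) (ev t)].
Proof.
move=> cU edgeU; have [vertex vU v0] := clique_vertex_at cU edgeU.
have [snapt codeE valid_ev] : exists2 snapt : 'I_side -> snapshot M,
    forall t, coords (vertex t) 1 == enum_rank (snapt t) & forall t,
      valid origin stop side bits (event_at (snapt t) (coords (vertex t))).
  apply: (@fin_all_exists2 _ (fun=> snapshot M)
    (fun t z => coords (vertex t) 1 == enum_rank z)
    (fun t z => valid origin stop side bits (event_at z (coords (vertex t))))).
  move=> t; have := edgeU _ _ (vU t) (vU t).
  by case/existsP=> z /existsP[z' /and5P[]]; exists z.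
pose ev (t : 'I_side) := event_at (snapt t) (coords (vertex t)).
have ev_time t : time (ev t) = t by rewrite /= (coords_ord _ ord0) v0.
exists ev => t; split=> [||s st]; [exact: ev_time | exact: valid_ev |].
have /existsP[z /existsP[z' /and5P[zE z'E _ _]]] := edgeU _ _ (vU s) (vU t).
have snap_inj r y : coords (vertex r) 1 == enum_rank y -> y = snapt r.
  by rewrite (eqP (codeE r)) => /eqP/val_inj/enum_rank_inj.
rewrite (snap_inj _ _ zE) (snap_inj _ _ z'E) -/(ev s) -/(ev t).
rewrite /ordered_compatible !ev_time st [t < s]ltnNge ltnW //= orbF.
rewrite agree_coords => /orP[/eqP vst|//].
by move: st; rewrite -(v0 s) vst v0 ltnn.
Qed.

Lemma clique_accepts (U : {set V}) : 0 < side ->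
  #|U| <= side -> side * side <= #|edges_within edge U| -> accepts M w.
Proof.
move=> side0 Us EU; have [cU edgeU] := edges_within_full Us EU.
have [ev evP] := clique_events cU edgeU.
pose sub t : 'I_side := insubd (Ordinal side0) t.
have subK t : t < side -> sub t = t :> nat by move=> ts; rewrite insubdK.
apply: (@consistent_accepts _ _ origin side (ev \o sub)) => //.
split=> [t ts|s t /andP[st ts]].
  by have [timeE val _] := evP (sub t); rewrite /= timeE subK.
have [_ _ com] := evP (sub t); apply: com.
by rewrite !subK // (ltn_trans st).
Qed.

End EventCliques.

(** * Polynomially bounded functions *)

Lemma leq_exp x y i n : x <= y -> 0 < y -> i <= n -> x ^ i <= y ^ n.
Proof.
move=> xy y0 le_in; apply: (@leq_trans (y ^ i)); last by rewrite leq_pexp2l.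
by case: i {le_in} => // i; rewrite leq_exp2r.
Qed.

Lemma leq_horner (p : {poly nat}) x y : x <= y -> (p.[x])%R <= (p.[y])%R.
Proof.
move=> xy; rewrite !horner_coef; apply: leq_sum => i _;
  rewrite leq_mul2l natrXE.
by apply/orP; right; rewrite natrXE; case: (i : nat) => // j; rewrite leq_exp2r.
Qed.

Lemma horner_le_power (p : {poly nat}) :
  exists c d, forall x, (p.[x])%R <= (x + c) ^ d.
Proof.
pose C := \sum_(i < size p) (p`_i)%R.
exists C.+1, (size p).+1 => x; rewrite horner_coef.
apply: (@leq_trans (\sum_(i < size p) (p`_i)%R * (x + C.+1) ^ size p)).
  apply: leq_sum => i _; apply: leq_mul => //; rewrite natrXE.
  by apply: leq_exp; rewrite ?leq_addr ?addnS // ltnW.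
by rewrite -big_distrl /= expnS leq_mul2r -/C addnS leqW ?leq_addl ?orbT.
Qed.

Definition poly_bounded (f : nat -> nat) :=
  exists p : {poly nat}, forall x, f x <= (p.[x])%R.

Lemma poly_bounded_const n : poly_bounded (fun=> n).
Proof. by exists (n%:P)%R => x; rewrite hornerC. Qed.

Lemma poly_bounded_id : poly_bounded id.
Proof. by exists 'X%R => x; rewrite hornerX. Qed.

Lemma poly_bounded_add f g :
  poly_bounded f -> poly_bounded g -> poly_bounded (fun x => f x + g x).
Proof.
by move=> [p fp] [q gq]; exists (p + q)%R => x; rewrite hornerD; apply: leq_add.
Qed.

Lemma poly_bounded_mul f g :
  poly_bounded f -> poly_bounded g -> poly_bounded (fun x => f x * g x).
Proof.
by move=> [p fp] [q gq]; exists (p * q)%R => x; rewrite hornerM; apply: leq_mul.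
Qed.

Lemma poly_bounded_exp f n : poly_bounded f -> poly_bounded (fun x => f x ^ n).
Proof.
case=> p fp; exists (p ^+ n)%R => x; rewrite horner_exp natrXE.
by case: n => // n; rewrite leq_exp2r.
Qed.

Lemma poly_bounded_comp f g :
  poly_bounded f -> poly_bounded g -> poly_bounded (fun x => f (g x)).
Proof.
move=> [p fp] [q gq]; exists (p \Po q)%R => x; rewrite horner_comp.
exact: leq_trans (fp _) (leq_horner p (gq x)).
Qed.

Ltac poly_bound := repeat first
  [ assumption | exact: poly_bounded_id | exact: poly_bounded_const
  | apply: poly_bounded_add | apply: poly_bounded_mul
  | apply: poly_bounded_exp ].

(** * Stack programs *)

Definition store := nat -> seq bool.
Definition upd (s : store) r v : store := fun r' => if r' == r then v else s r'.

(* Tests look at the top of a stack, which is None when the stack is empty. *)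
Definition test := option bool -> bool.

Inductive com :=
| Skip
| Push (r : nat) (b : bool)
| Pop (r : nat)
| Seq (c d : com)
| If (r : nat) (p : test) (c d : com)
| While (r : nat) (p : test) (c : com).

(* The last argument counts the machine steps of the compiled program. *)
Inductive exec : com -> store -> store -> nat -> Prop :=
| ExecSkip s : exec Skip s s 0
| ExecPush s r b : exec (Push r b) s (upd s r (b :: s r)) 2
| ExecPop s r : exec (Pop r) s (upd s r (behead (s r))) 1
| ExecSeq c d s s' s'' n n' :
    exec c s s' n -> exec d s' s'' n' -> exec (Seq c d) s s'' (n + n')
| ExecIfTrue r (p : test) c d s s' n :
    p (ohead (s r)) -> exec c s s' n -> exec (If r p c d) s s' (n + 1).+1
| ExecIfFalse r (p : test) c d s s' n :
    ~~ p (ohead (s r)) -> exec d s s' n -> exec (If r p c d) s s' n.+1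
| ExecWhileFalse r (p : test) c s :
    ~~ p (ohead (s r)) -> exec (While r p c) s s 1
| ExecWhileTrue r (p : test) c s s' s'' n n' :
    p (ohead (s r)) -> exec c s s' n -> exec (While r p c) s' s'' n' ->
    exec (While r p c) s s'' (n + n'.+1).+1.

(* A push is two instructions: moving left onto a blank cell, then writing. *)
Inductive instr :=
| MoveLeft (r : nat)
| Write (r : nat) (b : bool)
| Erase (r : nat)
| Jump (r : nat) (p : test) (target : nat).

Definition goto := Jump 0 (fun=> true).
Definition jump_unless r (p : test) := Jump r (fun x => ~~ p x).

Fixpoint code_size c :=
  match c with
  | Skip => 0
  | Push _ _ => 2
  | Pop _ => 1
  | Seq c d => code_size c + code_size d
  | If _ _ c d => (code_size c + (code_size d).+1).+1
  | While _ _ c => (code_size c).+2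
  end.

Fixpoint max_reg c :=
  match c with
  | Skip => 0
  | Push r _ | Pop r => r
  | Seq c d => maxn (max_reg c) (max_reg d)
  | If r _ c d => maxn r (maxn (max_reg c) (max_reg d))
  | While r _ c => maxn r (max_reg c)
  end.

Fixpoint compile pc c : seq instr :=
  match c with
  | Skip => [::]
  | Push r b => [:: MoveLeft r; Write r b]
  | Pop r => [:: Erase r]
  | Seq c d => compile pc c ++ compile (pc + code_size c) d
  | If r p c d =>
      jump_unless r p (pc + code_size c).+2 :: compile pc.+1 c ++
      goto (pc + code_size c + code_size d).+2 ::
        compile (pc + code_size c).+2 d
  | While r p c =>
      jump_unless r p (pc + code_size c).+2 :: compile pc.+1 c ++ [:: goto pc]
  end.

Lemma size_compile pc c : size (compile pc c) = code_size c.
Proof.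
elim: c pc => //= [c IHc d IHd|r p c IHc d IHd|r p c IHc] pc.
- by rewrite size_cat IHc IHd.
- by rewrite size_cat /= IHc IHd.
- by rewrite size_cat /= IHc addn1.
Qed.

Section Machine.
Variables (K : nat) (code : seq instr).
Local Notation symbol := (sym void).
Local Notation tp := 'I_K.+1.

Definition bit_of (x : symbol) : option bool :=
  if x is Some (inl b) then Some b else None.
Definition sym_of (b : bool) : symbol := Some (inl b).

Definition stay (r : {ffun tp -> symbol}) : {ffun tp -> symbol * move} :=
  [ffun i => (r i, MoveS)].

Definition on_tape k (y : symbol -> symbol * move) (r : {ffun tp -> symbol}) :=
  [ffun i : tp => if i == k :> nat then y (r i) else (r i, MoveS)].

Definition perform pc (x : instr) (r : {ffun tp -> symbol}) :
    nat * {ffun tp -> symbol * move} :=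
  match x with
  | MoveLeft k => (pc.+1, on_tape k (fun a => (a, MoveL)) r)
  | Write k b => (pc.+1, on_tape k (fun=> (sym_of b, MoveS)) r)
  | Erase k => (pc.+1, on_tape k (fun=> (None, MoveR)) r)
  | Jump k p t => (if p (bit_of (r (inord k))) then t else pc.+1, stay r)
  end.

Definition machine_trans (q : 'I_(size code).+1) (r : {ffun tp -> symbol}) :
    {set 'I_(size code).+1 * {ffun tp -> symbol * move}} :=
  if q < size code then
    let x := perform q (nth (goto 0) code q) r in [set (inord x.1, x.2)]
  else set0.

Definition machine : TM :=
  @MkTM K void 'I_(size code).+1 ord0 set0 machine_trans.

Lemma machine_deterministic : deterministic machine.
Proof.
by move=> q r; rewrite /= /machine_trans; case: ifP; rewrite ?cards1 ?cards0.
Qed.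

Definition holds (x : tape void) (s : seq bool) :=
  let: (l, a, r) := x in
  (forall i, nth None l i = None) /\
  (forall i, nth None (a :: r) i = nth None (map sym_of s) i).

Definition represents (x : {ffun tp -> tape void}) (s : store) :=
  forall i : tp, holds (x i) (s i).

Definition at_pc pc (x : {ffun tp -> tape void}) : config machine :=
  (inord pc, x).

Lemma holds_input_tape s : holds (input_tape void s) s.
Proof.
split=> [i|]; first by rewrite nth_nil.
by case: s => [|b s] //= -[|i] //=; rewrite nth_nil.
Qed.

Lemma holds_top x s : holds x s -> bit_of x.1.2 = ohead s.
Proof. by case: x => [[l a] r] [_ /(_ 0)] /= ->; case: s. Qed.

Lemma output_holds x s : holds x s -> output x = s.
Proof.
case: x => [[l a] r] [_]; rewrite /output; elim: s a r => [|b s IHs] a r xs.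
  by have /= -> := xs 0.
have /= -> := xs 0; congr (_ :: _).
case: r xs => [|a' r] xs; first by have := xs 1; case: s {IHs xs}.
by apply: IHs => i; have := xs i.+1.
Qed.

Lemma write_stay (x : tape void) : write_move (x.1.2, MoveS) x = x.
Proof. by case: x => [[l a] r]. Qed.

Lemma step_at_pc pc (x : {ffun tp -> tape void}) :
  pc < size code ->
  let a := perform pc (nth (goto 0) code pc) [ffun i => (x i).1.2] in
  step (at_pc pc x) (at_pc a.1 [ffun i => write_move (a.2 i) (x i)]).
Proof.
move=> pc_lt a; exists (inord a.1, a.2) => //.
rewrite /options /= /machine_trans inordK ?pc_lt; last exact: ltnW.
by rewrite in_set1 /a.
Qed.

Definition code_at pc (l : seq instr) := take (size l) (drop pc code) = l.

Lemma code_at_cat pc l l' :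
  code_at pc (l ++ l') -> code_at pc l /\ code_at (pc + size l) l'.
Proof.
rewrite /code_at => ll'; split.
  have := take_size_cat l' (erefl (size l)).
  by rewrite -{1}ll' take_takel // size_cat leq_addr.
by rewrite addnC -drop_drop take_drop [size l' + _]addnC -size_cat ll'
  drop_size_cat.
Qed.

Lemma code_at_cons pc x l :
  code_at pc (x :: l) ->
  [/\ pc < size code, nth (goto 0) code pc = x & code_at pc.+1 l].
Proof.
move=> xl; have [_] := code_at_cat (xl : code_at pc ([:: x] ++ l));
  rewrite addn1 => lE.
have pc_lt : pc < size code.
  rewrite ltnNge; apply/negP=> ge; move: xl; rewrite /code_at drop_oversize //.
split=> //; by move: xl; rewrite /code_at (drop_nth (goto 0) pc_lt) => -[].
Qed.

Lemma step_jump pc (x : {ffun tp -> tape void}) s k p t l :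
  k <= K -> code_at pc (Jump k p t :: l) -> represents x s ->
  step (at_pc pc x) (at_pc (if p (ohead (s k)) then t else pc.+1) x).
Proof.
move=> kK /code_at_cons[pc_lt xE _] xs; have := step_at_pc x pc_lt.
rewrite xE /= ffunE (holds_top (xs _)) inordK //.
suff -> : [ffun i => write_move (stay [ffun i => (x i).1.2] i) (x i)] = x by [].
by apply/ffunP => i; rewrite !ffunE write_stay.
Qed.

Definition simulates c s s' n := forall pc x,
  code_at pc (compile pc c) -> max_reg c <= K -> represents x s ->
  exists2 x', represents x' s' &
    steps n (at_pc pc x) (at_pc (pc + code_size c) x').

Lemma simulates_push s r b : simulates (Push r b) s (upd s r (b :: s r)) 2.
Proof.
move=> pc x /= /code_at_cons[pc_lt pcE /code_at_cons[pc1_lt pc1E _]] _ xs.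
have := step_at_pc x pc_lt; rewrite pcE /=; set x1 := [ffun i => _] => step1.
have := step_at_pc x1 pc1_lt; rewrite pc1E /=; set x2 := [ffun i => _] => step2.
exists x2; last by rewrite addn2; exists (at_pc pc.+1 x1) => //;
  exists (at_pc pc.+2 x2).
move=> i; rewrite /x2 ffunE ffunE /upd; have := xs i.
rewrite /x1 !ffunE; case: eqP => [<-|_]; last by case: (x i) => [[l a] t].
case: (x i) => [[l a] t] [hl ht] /=; split=> [j|[|j]] //=.
by rewrite nth_behead hl.
Qed.

Lemma simulates_pop s r : simulates (Pop r) s (upd s r (behead (s r))) 1.
Proof.
move=> pc x /= /code_at_cons[pc_lt pcE _] _ xs.
have := step_at_pc x pc_lt; rewrite pcE /=; set x1 := [ffun i => _] => step1.
exists x1; last by rewrite addn1; exists (at_pc pc.+1 x1).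
move=> i; have := xs i; rewrite /x1 !ffunE /upd; case: eqP => [<-|_];
  last by rewrite write_stay.
case: (x i) => [[l a] t] [hl ht] /=; split=> [[|j]|j] //=.
have -> : nth None (head None t :: behead t) j = nth None (a :: t) j.+1.
  by case: t {ht} => //; case: j => //= j; rewrite nth_nil.
by rewrite ht; case: (s i) => //=; rewrite nth_nil.
Qed.

Lemma simulates_seq c d s s' s'' n n' :
  simulates c s s' n -> simulates d s' s'' n' ->
  simulates (Seq c d) s s'' (n + n').
Proof.
move=> simc simd pc x /= /code_at_cat[codec coded].
rewrite geq_max => /andP[hc hd] xs.
have [x1 xs1 run1] := simc pc x codec hc xs; rewrite size_compile in coded.
have [x2 xs2 run2] := simd _ _ coded hd xs1.
by exists x2 => //; rewrite addnA; apply: steps_trans run1 run2.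
Qed.

Lemma simulates_if_true r (p : test) c d s s' n :
  p (ohead (s r)) -> simulates c s s' n ->
  simulates (If r p c d) s s' (n + 1).+1.
Proof.
move=> pr simc pc x /= codeP; rewrite !geq_max => /and3P[hr hc _] xs.
have := step_jump hr codeP xs; rewrite pr /= => test_step.
have [_ _ /code_at_cat[codec]] := code_at_cons codeP.
rewrite size_compile => coded.
have [x1 xs1 run1] := simc _ _ codec hc xs.
have := step_jump (leq0n K) coded xs1; rewrite /= => exit_step.
exists x1 => //; exists (at_pc pc.+1 x) => //.
apply/(steps_trans run1)/steps1; move: exit_step.
by congr (step _ (at_pc _ _)); lia.
Qed.

Lemma simulates_if_false r (p : test) c d s s' n :
  ~~ p (ohead (s r)) -> simulates d s s' n -> simulates (If r p c d) s s' n.+1.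
Proof.
move=> pr simd pc x /= codeP; rewrite !geq_max => /and3P[hr _ hd] xs.
have := step_jump hr codeP xs; rewrite pr /= => test_step.
have [_ _ /code_at_cat[_ /code_at_cons[_ _]]] := code_at_cons codeP.
rewrite size_compile addSn => coded; have [x1 xs1 run1] := simd _ _ coded hd xs.
exists x1 => //; exists (at_pc (pc + code_size c).+2 x) => //.
by move: run1; congr (steps _ _ (at_pc _ _)); lia.
Qed.

Lemma simulates_while_false r (p : test) c s :
  ~~ p (ohead (s r)) -> simulates (While r p c) s s 1.
Proof.
move=> pr pc x /= codeP; rewrite geq_max => /andP[hr _] xs; exists x => //.
by apply: steps1; have := step_jump hr codeP xs; rewrite pr !addnS.
Qed.

Lemma simulates_while_true r (p : test) c s s' s'' n n' :
  p (ohead (s r)) -> simulates c s s' n -> simulates (While r p c) s' s'' n' ->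
  simulates (While r p c) s s'' (n + n'.+1).+1.
Proof.
move=> pr simc simw pc x codeP hK xs; move: (codeP) (hK).
rewrite /= geq_max => codeP' /andP[hr hc].
have := step_jump hr codeP' xs; rewrite pr /= => test_step.
have [_ _ /code_at_cat[codec]] := code_at_cons codeP'.
rewrite size_compile => code_back.
have [x1 xs1 run1] := simc _ _ codec hc xs.
have := step_jump (leq0n K) code_back xs1; rewrite /= => back_step.
have [x2 xs2 run2] := simw _ _ codeP hK xs1; exists x2 => //.
by exists (at_pc pc.+1 x) => //; apply: steps_trans run1 _;
  exists (at_pc pc x1).
Qed.

Lemma exec_simulates c s s' n : exec c s s' n -> simulates c s s' n.
Proof.
elim=> {c s s' n} [s|s r b|s r|c d s s' s'' n n' _ + _|r p c d s s' n + _
  |r p c d s s' n + _|r p c s|r p c s s' s'' n n' + _ + _].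
- by move=> pc x _ _ xs; exists x; rewrite ?addn0.
- exact: simulates_push.
- exact: simulates_pop.
- exact: simulates_seq.
- exact: simulates_if_true.
- exact: simulates_if_false.
- exact: simulates_while_false.
- exact: simulates_while_true.
Qed.

End Machine.

Lemma steps_halted (M : TM) n n' (c d e : config M) :
  deterministic M -> steps n c d -> halted d -> steps n' c e -> n' <= n.
Proof.
move=> det; elim: n n' c => [|n IHn] [|n'] c //=.
  by move=> -> hd [e' [a ac _]]; move: ac; rewrite hd inE.
case=> c1 [a ac ->] run hd [c2 [a' ac' ->]] run'.
have aa' : a = a'.
  by move/card_le1_eqP: (det c.1 [ffun i => (c.2 i).1.2]); apply.
by rewrite -aa' in run'; apply: IHn run hd run'.
Qed.

Definition input_store (w : seq bool) : store :=
  fun r => if r == 0 then w else [::].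

Lemma exec_machine c w s n :
  exec c (input_store w) s n ->
  let M := machine (max_reg c) (compile 0 c) in
  exists e : config M,
    [/\ steps n (init M w) e, halted e & output (e.2 ord0) = s 0].
Proof.
move=> run M; have w_init : represents (init M w).2 (input_store w).
  by move=> i; rewrite ffunE; apply: holds_input_tape.
have [|x xs st] :=
  @exec_simulates (max_reg c) (compile 0 c) _ _ _ _ run 0 _ _ (leqnn _) w_init.
  by rewrite /code_at drop0 take_size.
exists (at_pc (compile 0 c) (code_size c) x); split.
- move: st; congr steps; congr (_, _).
  by apply: val_inj; rewrite /= inordK.
- by rewrite /halted /options /= /machine_trans inordK size_compile ?ltnn.
- exact: output_holds (xs ord0).
Qed.

Theorem program_poly_computable (c : com) (f : seq bool -> seq bool)
    (tau : nat -> nat) :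
  poly_bounded tau ->
  (forall w, exists s n,
    [/\ exec c (input_store w) s n, s 0 = f w & n <= tau (size w)]) ->
  poly_computable f.
Proof.
move=> [p tau_p] runc; exists (machine (max_reg c) (compile 0 c)).
split; first exact: machine_deterministic.
  exists p => w n e st; have [s [n' [run _ le]]] := runc w.
  have [e' [st' halt _]] := exec_machine run; apply: leq_trans (tau_p _).
  exact: leq_trans (steps_halted (@machine_deterministic _ _) st' halt st) le.
move=> w; have [s [n [run <- _]]] := runc w.
by have [e he] := exec_machine run; exists n, e.
Qed.

(** * Programs for copying, comparing and counting *)

Definition runs c s s' n := exists2 n', n' <= n & exec c s s' n'.

Lemma runs_le c s s' n n' : runs c s s' n -> n <= n' -> runs c s s' n'.
Proof. by case=> k kn run nn'; exists k => //; apply: leq_trans nn'. Qed.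

Lemma runs_ext c s s' s'' n : s' =1 s'' -> runs c s s' n -> runs c s s'' n.
Proof. by move=> /funext ->. Qed.

Lemma runs_skip s n : runs Skip s s n.
Proof. by exists 0 => //; constructor. Qed.

Lemma runs_push s r b : runs (Push r b) s (upd s r (b :: s r)) 2.
Proof. by exists 2 => //; constructor. Qed.

Lemma runs_pop s r : runs (Pop r) s (upd s r (behead (s r))) 1.
Proof. by exists 1 => //; constructor. Qed.

Lemma runs_seq c d s s' s'' n n' :
  runs c s s' n -> runs d s' s'' n' -> runs (Seq c d) s s'' (n + n').
Proof.
case=> k kn run [k' kn' run']; exists (k + k'); first exact: leq_add.
exact: ExecSeq run run'.
Qed.

Lemma runs_if r (p : test) c d s s' n :
  (if p (ohead (s r)) then runs c s s' n else runs d s s' n) ->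
  runs (If r p c d) s s' n.+2.
Proof.
case: ifP => pr [k kn run].
  by exists (k + 1).+1; [rewrite addn1 | apply: ExecIfTrue].
by exists k.+1; [rewrite ltnW | apply: ExecIfFalse; rewrite ?pr].
Qed.

Lemma runs_while (sg : nat -> store) r (p : test) c N n s s' :
  sg 0 =1 s -> sg N =1 s' ->
  (forall i, i < N -> p (ohead (sg i r)) /\ runs c (sg i) (sg i.+1) n) ->
  ~~ p (ohead (sg N r)) -> runs (While r p c) s s' (N * n.+2).+1.
Proof.
move=> /funext <- /funext <- {s s'}.
elim: N sg => [|N IHN] sg body exit; first by exists 1 => //;
  apply: ExecWhileFalse.
have [p0 [k kn run]] := body 0 (ltn0Sn _).
have [i iN|k' k'n run'] := IHN (fun i => sg i.+1) _ exit; first exact: body.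
exists (k + k'.+1).+1; first by lia.
exact: ExecWhileTrue p0 run run'.
Qed.

Ltac upd_cases := let r := fresh "r" in move=> r; rewrite /upd /=;
  repeat (case: eqP => [?|?]; try subst r; rewrite //=).

Definition nonempty : test := isSome.
Definition istrue : test := fun x => x == Some true.

Definition Each a (c : bool -> com) :=
  While a nonempty (If a istrue (Seq (Pop a) (c true)) (Seq (Pop a) (c false))).

Definition PushAll (ds : seq nat) (g : nat -> bool -> bool) (b : bool) : com :=
  foldr (fun r c => Seq (Push r (g r b)) c) Skip ds.

Definition Transfer a ds g := Each a (PushAll ds g).

Lemma runs_push_all ds g b s : uniq ds ->
  runs (PushAll ds g b) s (fun r => if r \in ds then g r b :: s r else s r)
    (2 * size ds).
Proof.
elim: ds s => [|d ds IHds] s /=; first by move=> _; apply: runs_skip.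
case/andP=> dds /IHds run; rewrite mulnS; apply: runs_seq (runs_push _ _ _) _.
apply: runs_ext (run _) => r; rewrite inE /upd; case: eqP => [->|//].
by rewrite (negPf dds).
Qed.

Lemma runs_transfer a ds g s : a \notin ds -> uniq ds ->
  runs (Transfer a ds g) s
    (fun r => if r == a then [::]
              else if r \in ds then rev [seq g r b | b <- s a] ++ s r else s r)
    (size (s a) * (2 * size ds + 5)).+1.
Proof.
move=> ads uds; have -> : 2 * size ds + 5 = (1 + 2 * size ds).+4 by lia.
pose sg i : store := fun r => if r == a then drop i (s a)
  else if r \in ds then rev [seq g r b | b <- take i (s a)] ++ s r else s r.
apply: (runs_while (sg := sg)).
- by move=> r; rewrite /sg drop0 take0; case: eqP => [->|] //; case: ifP.
- by move=> r; rewrite /sg drop_size take_size.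
- move=> i iN; rewrite {1}/sg eqxx (drop_nth false iN); split=> //.
  set b := nth false (s a) i.
  have run :
    runs (Seq (Pop a) (PushAll ds g b)) (sg i) (sg i.+1) (1 + 2 * size ds).
    apply: runs_seq (runs_pop _ _) _;
      apply: runs_ext (runs_push_all g b _ uds) => r.
    rewrite /upd /sg; case: eqP => [->|_].
      by rewrite (negPf ads) eqxx (drop_nth false iN).
    by case: (r \in ds) => //; rewrite (take_nth false iN) map_rcons rev_rcons.
  apply: runs_if; rewrite {1}/sg eqxx (drop_nth false iN) -/b.
  by case: (b) run.
- by rewrite /sg eqxx drop_size.
Qed.

Definition unchanged (r : nat) (b : bool) := b.
Definition MoveTo a b := Transfer a [:: b] unchanged.
Definition CopyTo a b t := Seq (MoveTo a t) (Transfer t [:: a; b] unchanged).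

Lemma runs_move_to a b s : a != b ->
  runs (MoveTo a b) s (upd (upd s b (rev (s a) ++ s b)) a [::])
    (size (s a) * 7).+1.
Proof.
move=> ab; apply: runs_ext (runs_transfer unchanged s _ _) => //;
  last by rewrite inE.
move=> r; rewrite /upd inE /unchanged map_id; case: eqP => // _.
by case: eqP => // ->.
Qed.

Lemma runs_copy_to a b t s : a != b -> a != t -> b != t -> s t = [::] ->
  runs (CopyTo a b t) s (upd s b (s a ++ s b)) (size (s a) * 16).+2.
Proof.
move=> ab ta bt st.
apply: (runs_le (n := (size (s a) * 7).+1 + (size (s a) * 9).+1)); last by lia.
apply: runs_seq (runs_move_to _ ta) _; set s1 := upd _ _ _.
have s1t : s1 t = rev (s a) by rewrite /s1 /upd eq_sym (negPf ta) eqxx st cats0.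
have -> : size (s a) = size (s1 t) by rewrite s1t size_rev.
apply: runs_ext (runs_transfer unchanged s1 (ds := [:: a; b]) _ _) => //=.
- move=> r; rewrite !inE /unchanged map_id s1t revK /s1 /upd.
  have [->|_] := eqVneq r t; first by rewrite eq_sym (negPf bt) st.
  have [->|_] := eqVneq r b; first by rewrite orbT eq_sym (negPf ab).
  by rewrite orbF; have [->|] := eqVneq r a; rewrite ?cats0.
- by rewrite !inE negb_or ![t == _]eq_sym ta bt.
- by rewrite inE ab.
Qed.

Fixpoint PushOnes n r :=
  if n is n'.+1 then Seq (Push r true) (PushOnes n' r) else Skip.

Lemma runs_push_ones n r s :
  runs (PushOnes n r) s (upd s r (nseq n true ++ s r)) (2 * n).
Proof.
elim: n s => [|n IHn] s /=.
  by apply: runs_ext (runs_skip _ _) => r'; rewrite /upd; case: eqP => [->|].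
rewrite mulnS; apply: runs_seq (runs_push _ _ _) _;
  apply: runs_ext (IHn _) => r'.
rewrite /upd eqxx; case: eqP => // _.
by rewrite -cat_rcons -[rcons _ _]cats1 -(nseqD n 1) addn1.
Qed.

Definition Clear a := While a nonempty (Pop a).

Lemma runs_clear a s : runs (Clear a) s (upd s a [::]) (size (s a) * 3).+1.
Proof.
apply: (runs_while (sg := fun i => upd s a (drop i (s a)))).
- by move=> r; rewrite /upd drop0; case: eqP => [->|].
- by rewrite drop_size.
- move=> i iN; rewrite {1}/upd eqxx (drop_nth false iN); split=> //.
  by apply: runs_ext (runs_pop _ _) => r; rewrite /upd eqxx; case: eqP.
- by rewrite /upd eqxx drop_size.
Qed.

Definition DropBoth a b := While a nonempty (Seq (Pop a) (Pop b)).

Lemma runs_drop_both a b s : a != b ->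
  runs (DropBoth a b) s (upd (upd s b (drop (size (s a)) (s b))) a [::])
    (size (s a) * 4).+1.
Proof.
move=> ab; apply: (runs_while
  (sg := fun i => upd (upd s b (drop i (s b))) a (drop i (s a)))).
- move=> r; rewrite /upd !drop0; case: eqP => [->|_] //; by case: eqP => [->|].
- by rewrite drop_size.
- move=> i iN; rewrite {1}/upd eqxx (drop_nth false iN); split=> //.
  apply: runs_ext (runs_seq (runs_pop _ _) (runs_pop _ _)) => r;
    rewrite /upd !eqxx.
  rewrite [b == a]eq_sym (negPf ab) -[behead (drop i _)]drop1 drop_drop.
  rewrite add1n /=.
  case: (r =P b) => [->|_]; first by rewrite eq_sym (negPf ab).
  by case: eqP.
- by rewrite /upd eqxx drop_size.
Qed.

(* Registers 1-3 are scratch space.  The variables are the sizes of the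
   registers from 6 on; that of variable 0 is also read as a bit array. *)
Notation out_reg := 0 (only parsing).
Notation flag_reg := 4 (only parsing).
Notation tally_reg := 5 (only parsing).
Definition var_reg i := i.+4.+2.

Definition scratch_empty (s : store) :=
  [/\ s 1 = [::], s 2 = [::] & s 3 = [::]].

(* Register 2 keeps the part of the second operand that exceeds the first. *)
Definition Difference m i n j :=
  Seq (CopyTo i 1 3) (Seq (PushOnes m 1) (Seq (CopyTo j 2 3)
    (Seq (PushOnes n 2) (DropBoth 1 2)))).

Lemma runs_difference m i n j b s :
  scratch_empty s -> size (s (var_reg i)) <= b -> size (s (var_reg j)) <= b ->
  runs (Difference m (var_reg i) n (var_reg j)) s
    (upd s 2 (drop (m + size (s (var_reg i))) (nseq n true ++ s (var_reg j))))
    (36 * b + 6 * m + 2 * n + 5).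
Proof.
move=> [s1 s2 s3] ib jb; set x := drop _ _.
pose a1 := upd s 1 (s (var_reg i)).
pose a2 := upd s 1 (nseq m true ++ s (var_reg i)).
pose a3 := upd a2 2 (s (var_reg j)).
pose a4 := upd a2 2 (nseq n true ++ s (var_reg j)).
have copy_i : runs (CopyTo (var_reg i) 1 3) s a1 (b * 16).+2.
  apply: runs_le (runs_ext _ (runs_copy_to _ _ _ s3)) _ => //; last by lia.
  by rewrite /a1; upd_cases; rewrite s1 cats0.
have add_m : runs (PushOnes m 1) a1 a2 (2 * m).
  by apply: runs_ext (runs_push_ones _ _ _); rewrite /a1 /a2; upd_cases.
have copy_j : runs (CopyTo (var_reg j) 2 3) a2 a3 (b * 16).+2.
  apply: runs_le (runs_ext _ (runs_copy_to _ _ _ (s3 : a2 3 = [::]))) _ => //.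
    by rewrite /a3 /a2; upd_cases; rewrite s2 cats0.
  by rewrite /a2 /upd /=; lia.
have add_n : runs (PushOnes n 2) a3 a4 (2 * n).
  by apply: runs_ext (runs_push_ones _ _ _); rewrite /a3 /a4; upd_cases.
have cancel : runs (DropBoth 1 2) a4 (upd s 2 x) ((b + m) * 4).+1.
  apply: runs_le (runs_ext _ (runs_drop_both _ _)) _ => //; last first.
    by rewrite /a4 /a2 /upd /= size_cat size_nseq; lia.
  by rewrite /a4 /a2; upd_cases; rewrite ?s1 ?s2 ?size_cat ?size_nseq.
apply: runs_le (runs_seq copy_i (runs_seq add_m (runs_seq copy_j
  (runs_seq add_n cancel)))) _; lia.
Qed.

Definition Compare m i n j p := Seq (Difference m i n j)
  (Seq (If 2 p (Push flag_reg true) (Push flag_reg false)) (Clear 2)).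

Lemma runs_compare m i n j (p : test) b s :
  let x := drop (m + size (s (var_reg i))) (nseq n true ++ s (var_reg j)) in
  scratch_empty s -> size (s (var_reg i)) <= b -> size (s (var_reg j)) <= b ->
  runs (Compare m (var_reg i) n (var_reg j) p) s
    (upd s flag_reg (p (ohead x) :: s flag_reg)) (50 * (b + m + n) + 50).
Proof.
move=> x se ib jb; have [_ s2 _] := se.
have xb : size x <= b + n by rewrite size_drop size_cat size_nseq; lia.
pose a := upd (upd s 2 x) flag_reg (p (ohead x) :: s flag_reg).
have answer :
  runs (If 2 p (Push flag_reg true) (Push flag_reg false)) (upd s 2 x) a 4.
  apply: runs_if; rewrite -[upd s 2 x 2]/x /a.
  by case: (p (ohead x)); apply: runs_ext (runs_push _ _ _); upd_cases.
have tidy : runs (Clear 2) a (upd s flag_reg (p (ohead x) :: s flag_reg))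
    ((b + n) * 3).+1.
  apply: runs_le (runs_ext _ (runs_clear _ _)) _; last first.
    by rewrite /a /upd /=; lia.
  by rewrite /a; upd_cases; rewrite ?s2.
have subtract := runs_difference m n se ib jb.
by apply: runs_le (runs_seq subtract (runs_seq answer tidy)) _; lia.
Qed.

Inductive formula :=
| Less (m i n j : nat)
| Bit (i : nat)
| Truth
| Neg (e : formula)
| Conj (e e' : formula).

Fixpoint eval (e : formula) (val : nat -> nat) (bits : seq bool) : bool :=
  match e with
  | Less m i n j => m + val i < n + val j
  | Bit i => nth false bits (val i)
  | Truth => true
  | Neg e => ~~ eval e val bits
  | Conj e e' => eval e val bits && eval e' val bits
  end.

Fixpoint Decide (e : formula) : com :=
  match e with
  | Less m i n j => Compare m (var_reg i) n (var_reg j) nonempty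
  | Bit i => Compare 0 (var_reg i) 0 (var_reg 0) istrue
  | Truth => Push flag_reg true
  | Neg e => Seq (Decide e) (If flag_reg istrue
      (Seq (Pop flag_reg) (Push flag_reg false))
      (Seq (Pop flag_reg) (Push flag_reg true)))
  | Conj e e' => Seq (Decide e)
      (If flag_reg istrue (Seq (Pop flag_reg) (Decide e')) Skip)
  end.

Definition var_val (s : store) i := size (s (var_reg i)).
Definition store_eval e (s : store) := eval e (var_val s) (s (var_reg 0)).

Lemma runs_pop_flag s x :
  runs (Pop flag_reg) (upd s flag_reg (x :: s flag_reg)) s 1.
Proof. by apply: runs_ext (runs_pop _ _); upd_cases. Qed.

Lemma runs_decide e : exists2 tau, poly_bounded tau & forall s b,
  scratch_empty s -> (forall i, size (s (var_reg i)) <= b) ->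
  runs (Decide e) s (upd s flag_reg (store_eval e s :: s flag_reg)) (tau b).
Proof.
elim: e => [m i n j|i||e [t pt run_e]|e [t pt run_e] e' [t' pt' run_e']] /=.
- exists (fun b => 50 * (b + m + n) + 50); first by poly_bound.
  move=> s b se sb; have := runs_compare m n nonempty se (sb i) (sb j).
  congr (runs _ _ (upd _ _ (_ :: _)) _); rewrite /store_eval /= /var_val.
  set k := m + _; set l := _ ++ _.
  have -> : n + size (s (var_reg j)) = size l by rewrite size_cat size_nseq.
  by rewrite -subn_gt0 -size_drop; case: (drop k l).
- exists (fun b => 50 * (b + 0 + 0) + 50); first by poly_bound.
  move=> s b se sb; have := runs_compare 0 0 istrue se (sb i) (sb 0).
  congr (runs _ _ (upd _ _ (_ :: _)) _); rewrite /store_eval /= /var_val add0n.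
  move: (size _) (s (var_reg 0)) => k l; have [lt|ge] := ltnP k (size l).
    by rewrite (drop_nth false lt) /istrue /=; case: nth.
  by rewrite drop_oversize // nth_default.
- by exists (fun=> 2); [poly_bound | move=> s b _ _; apply: runs_push].
- exists (fun b => t b + 5); first by poly_bound.
  move=> s b se sb; apply: runs_seq (run_e s b se sb) _.
  apply: runs_if; rewrite {1}/upd /= /istrue /store_eval /=.
  by case: (eval e _ _); apply: runs_seq (runs_pop_flag _ _) (runs_push _ _ _).
- exists (fun b => t b + (1 + t' b + 2)); first by poly_bound.
  move=> s b se sb; apply: runs_seq (run_e s b se sb) _; rewrite addn2.
  apply: runs_if; rewrite {1}/upd /= /istrue /store_eval /=.
  case: (eval e _ _); last by apply: runs_ext (runs_skip _ _); upd_cases.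
  by apply: runs_seq (runs_pop_flag _ _) _; apply: run_e'.
Qed.

(** * Nested loops *)

Definition Cond e c d :=
  Seq (Decide e)
    (If flag_reg istrue (Seq (Pop flag_reg) c) (Seq (Pop flag_reg) d)).

Definition For bnd v c :=
  Seq (CopyTo bnd v 3) (While v nonempty (Seq (Pop v) c)).

Definition ForAll bnd vs c := foldr (For bnd) c vs.

(* The size of R is not bounded: R receives the output. *)
Definition ready bnd R (vs : seq nat) b (s : store) :=
  [/\ scratch_empty s, {in vs, forall v, s v = [::]},
      forall i, var_reg i != R -> size (s (var_reg i)) <= b
    & s bnd = nseq (size (s bnd)) true].

Definition emits bnd R vs c (g : store -> seq bool) :=
  (forall s x, g (upd s R x) = g s) /\
  exists2 tau, poly_bounded tau &
    forall s b, ready bnd R vs b s -> runs c s (upd s R (g s ++ s R)) (tau b).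

Lemma emits_skip bnd R : emits bnd R [::] Skip (fun=> [::]).
Proof.
split=> //; exists (fun=> 0) => [|s b _]; first by poly_bound.
by apply: runs_ext (runs_skip _ _) => r; rewrite /upd; case: eqP => [->|].
Qed.

Lemma emits_push bnd R b : emits bnd R [::] (Push R b) (fun=> [:: b]).
Proof.
by split=> //; exists (fun=> 2) => [|s n _]; [poly_bound | apply: runs_push].
Qed.

Lemma store_eval_upd e s R x :
  R < 6 -> store_eval e (upd s R x) = store_eval e s.
Proof.
move=> R6; have sE i : upd s R x (var_reg i) = s (var_reg i).
  by rewrite /upd; case: eqP R6 => [<-|].
by rewrite /store_eval sE; congr eval; apply/funext=> i; rewrite /var_val sE.
Qed.

Lemma emits_cond bnd R vs e c d g h : R < 6 ->
  emits bnd R vs c g -> emits bnd R vs d h ->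
  emits bnd R vs (Cond e c d) (fun s => if store_eval e s then g s else h s).
Proof.
move=> R6 [gR [tc ptc runc]] [hR [td ptd rund]].
split=> [s x|]; first by rewrite store_eval_upd // gR hR.
have [t pt rune] := runs_decide e.
exists (fun b => t b + (1 + (tc b + td b) + 2)); first by poly_bound.
move=> s b rs; have [se _ sb _] := rs; apply: runs_seq (rune s b se _) _.
  by move=> i; apply: sb; case: eqP R6 => [<-|].
rewrite addn2; apply: runs_if; rewrite {1}/upd /= /istrue.
case: (store_eval e s); apply: runs_seq (runs_pop_flag _ _) _.
  by apply: runs_le (runc s b rs) _; rewrite leq_addr.
by apply: runs_le (rund s b rs) _; rewrite leq_addl.
Qed.

Lemma emits_ext bnd R vs c g g' : g =1 g' -> emits bnd R vs c g ->
  emits bnd R vs c g'.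
Proof. by move/funext->. Qed.

Section ForLoop.
Variables (bnd R v : nat) (vs : seq nat) (c : com) (g : store -> seq bool).
Hypotheses (bnd_var : 5 < bnd) (v_var : 5 < v).
Hypothesis R_scratch : R \notin [:: 1; 2; 3].
Hypotheses (bnd_R : bnd != R) (v_R : v != R) (v_bnd : v != bnd).
Hypotheses (v_vs : v \notin vs) (R_vs : R \notin vs).
Hypothesis gR : forall s x, g (upd s R x) = g s.
Variable tau : nat -> nat.
Hypothesis run_body : forall s b,
  ready bnd R vs b s -> runs c s (upd s R (g s ++ s R)) (tau b).

Section Iteration.
Variables (s : store) (b : nat).
Hypothesis s_ready : ready bnd R (v :: vs) b s.
Local Notation N := (size (s bnd)).

Definition for_output k :=
  flatten [seq g (upd s v (nseq x true)) | x <- iota (N - k) k].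
Definition for_store k : store :=
  upd (upd s v (nseq (N - k) true)) R (for_output k ++ s R).

Lemma size_bnd_le : N <= b.
Proof.
have [_ _ sb _] := s_ready; have bndE : bnd = var_reg (bnd - 6).
  by rewrite /var_reg; move: bnd_var; lia.
by rewrite bndE; apply: sb; rewrite -bndE.
Qed.

Lemma for_store_ready k x :
  size x <= b -> ready bnd R vs b (upd (upd s v x) R (for_output k ++ s R)).
Proof.
have [[s1 s2 s3] svs sb sbnd] := s_ready => xb; set s' := upd _ _ _.
have s'E r : r != v -> r != R -> s' r = s r.
  by move=> /negPf rv /negPf rR; rewrite /s' /upd rR rv.
split.
- move: R_scratch; rewrite !inE !negb_or => /and3P[R1 R2 R3].
  by split; rewrite s'E 1?[_ == R]eq_sym //; move: v_var; lia.
- move=> u uvs; rewrite s'E ?svs ?inE ?uvs ?orbT //.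
    by apply: contraNneq v_vs => <-.
  by apply: contraNneq R_vs => <-.
- move=> i iR; have [iv|iv] := eqVneq (var_reg i) v; last by rewrite s'E // sb.
  by rewrite iv /s' /upd (negPf v_R) eqxx.
- by rewrite s'E // eq_sym.
Qed.

Lemma runs_for_body k :
  k < N -> runs (Seq (Pop v) c) (for_store k) (for_store k.+1) (1 + tau b).
Proof.
move=> kN; have Nk : N - k = (N - k.+1).+1 by lia.
apply: runs_seq (runs_pop _ _) _; set s' := upd (for_store k) v _.
have s'E : s' = upd (upd s v (nseq (N - k.+1) true)) R (for_output k ++ s R).
  apply/funext=> r; rewrite /s' /for_store /upd (negPf v_R) eqxx Nk /=.
  by case: eqP => [->|//]; rewrite (negPf v_R).
have s'_ready : ready bnd R vs b s'.
  by rewrite s'E; apply: for_store_ready; rewrite size_nseq;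
    have := size_bnd_le; lia.
apply: runs_ext (run_body s'_ready) => r.
rewrite s'E gR /for_store /upd eqxx; case: eqP => // _; rewrite catA;
  congr (_ ++ _).
by rewrite /for_output Nk.
Qed.

Lemma runs_for :
  runs (For bnd v c) s
    (upd s R (flatten [seq g (upd s v (nseq x true)) | x <- iota 0 N] ++ s R))
    ((b * 16 + 2) + (b * (1 + tau b + 2) + 1)).
Proof.
have [[_ _ s3] svs _ sbnd] := s_ready; have Nb := size_bnd_le.
have sv : s v = [::] by rewrite svs ?mem_head.
rewrite !addn1 !addn2; apply: runs_seq.
  apply: runs_le (runs_copy_to (t := 3) _ _ _ s3) _.
  - by rewrite eq_sym.
  - by move: bnd_var; lia.
  - by move: v_var; lia.
  - by rewrite !ltnS leq_mul2r Nb orbT.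
apply: runs_le (runs_while (sg := for_store) (N := N) _ _ _ _) _.
- move=> r; rewrite /for_store /for_output /upd subn0 sv cats0 -sbnd.
  by have [->|_] := eqVneq r R; rewrite // [R == v]eq_sym (negPf v_R).
- move=> r; rewrite /for_store /for_output /upd subnn.
  by case: eqP => // _; case: eqP => // ->; rewrite sv.
- move=> k kN; split; last exact: runs_for_body.
  by rewrite /for_store /upd (negPf v_R) eqxx -(subnSK kN).
- by rewrite /for_store /upd (negPf v_R) eqxx subnn.
- by rewrite ltnS leq_mul2r Nb orbT.
Qed.

End Iteration.
End ForLoop.

Lemma emits_for bnd R vs v c g :
  5 < bnd -> 5 < v -> R \notin [:: 1; 2; 3] -> bnd != R -> v != R -> v != bnd ->
  v \notin vs -> R \notin vs -> emits bnd R vs c g ->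
  emits bnd R (v :: vs) (For bnd v c)
    (fun s => flatten [seq g (upd s v (nseq x true))
      | x <- iota 0 (size (s bnd))]).
Proof.
move=> bnd5 v5 R3 bR vR vb vvs Rvs [gR [t pt run]]; split=> [s x|].
  have -> : upd s R x bnd = s bnd by rewrite /upd (negPf bR).
  congr flatten; apply: eq_map => k; rewrite -(gR (upd s v (nseq k true)) x).
  congr g; apply/funext => r; rewrite /upd.
  by case: eqP => // ->; rewrite (negPf vR).
exists (fun b => (b * 16 + 2) + (b * (1 + t b + 2) + 1)); first by poly_bound.
by move=> s b; apply: runs_for.
Qed.

Definition digit b D i k := (i %/ b ^ (D - k.+1)) %% b.

Lemma digit_mod b n i k :
  k < n -> digit b n (i %% b ^ n) k = digit b n.+1 i k.+1.
Proof.
move=> kn; rewrite /digit subSS; set m := n - k.+1.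
have -> : n = k.+1 + m by lia.
by rewrite expnD -modn_divl modn_dvdm // expnS dvdn_mulr.
Qed.

Lemma digit_first b n i : i < b ^ n.+1 -> digit b n.+1 i 0 = i %/ b ^ n.
Proof.
move=> i_lt; rewrite /digit subSS subn0 modn_small // ltn_divLR -?expnS //.
by move: i_lt; rewrite expnS; case: (b ^ n); rewrite ?muln0.
Qed.

Lemma digit_inj b D i i' : i < b ^ D -> i' < b ^ D ->
  (forall k, k < D -> digit b D i k = digit b D i' k) -> i = i'.
Proof.
elim: D i i' => [|D IHD] i i'.
  by rewrite expn0 !ltnS !leqn0 => /eqP-> /eqP->.
move=> i_lt i'_lt ii'; have b0 : 0 < b ^ D.
  by move: i_lt; rewrite expnS; case: (b ^ D); rewrite ?muln0.
rewrite (divn_eq i (b ^ D)) (divn_eq i' (b ^ D)) -!digit_first // ii' //;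
  congr (_ + _).
apply: IHD; rewrite ?ltn_mod // => k kD; rewrite !digit_mod //; exact: ii'.
Qed.

Fixpoint assign b vs (s : store) i : store :=
  if vs is v :: vs' then
    assign b vs' (upd s v (nseq (i %/ b ^ size vs') true)) (i %% b ^ size vs')
  else s.

Lemma assignE b vs s i r : uniq vs -> i < b ^ size vs ->
  assign b vs s i r =
  if r \in vs then nseq (digit b (size vs) i (index r vs)) true else s r.
Proof.
elim: vs s i => //= v vs IHvs s i /andP[vvs uvs] i_lt.
have b0 : 0 < b ^ size vs.
  by move: i_lt; rewrite expnS; case: (b ^ _); rewrite ?muln0.
rewrite IHvs ?ltn_mod // inE /upd; have [rvs|rvs] := boolP (r \in vs).
  by rewrite orbT; case: eqP rvs vvs => [<- ->|_ rvs _] //;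
    rewrite digit_mod // index_mem.
by rewrite orbF; case: eqP => // ->; rewrite eqxx digit_first.
Qed.

Lemma assign_notin b vs s i r : r \notin vs -> assign b vs s i r = s r.
Proof.
elim: vs s i => //= v vs IHvs s i; rewrite inE negb_or => /andP[rv rvs].
by rewrite IHvs // /upd (negPf rv).
Qed.

Lemma flatten_iota (T : Type) (F : nat -> nat -> seq T) n b :
  flatten [seq flatten [seq F x y | y <- iota 0 n] | x <- iota 0 b] =
  flatten [seq F (i %/ n) (i %% n) | i <- iota 0 (b * n)].
Proof.
elim: b => [|b IHb]; first by rewrite mul0n.
rewrite -addn1 iotaD map_cat flatten_cat IHb addn1 mulSnr iotaD map_cat
  flatten_cat.
congr (_ ++ _); rewrite /= cats0 !add0n -[b * n]addn0 iotaDl -map_comp;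
  congr flatten.
apply/eq_in_map => y; rewrite mem_iota /= add0n => yn /=.
have n0 : 0 < n by apply: leq_trans yn.
by rewrite divnMDl // modnMDl divn_small ?modn_small // addn0.
Qed.

(* Loop registers start at 12, after the scratch registers and the variables. *)
Lemma emits_for_all bnd R vs ws c g :
  5 < bnd < 12 -> R < 12 -> R \notin [:: 1; 2; 3] -> bnd != R ->
  uniq (vs ++ ws) -> all (leq 12) (vs ++ ws) -> emits bnd R ws c g ->
  emits bnd R (vs ++ ws) (ForAll bnd vs c)
    (fun s => flatten [seq g (assign (size (s bnd)) vs s i)
      | i <- iota 0 (size (s bnd) ^ size vs)]).
Proof.
case/andP=> bnd5 bnd12 R12 R3 bR + + em.
elim: vs => [|v vs IHvs] /=.
  by move=> _ _; apply: emits_ext em => s /=; rewrite cats0.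
case/andP=> vvs uvs /andP[v12 vs12].
have notin r : r < 12 -> r \notin vs ++ ws.
  by move=> r12; apply: contraL r12 => /(allP vs12); rewrite -leqNgt.
have neq r : r < 12 -> v != r by move=> r12; rewrite gtn_eqF // (leq_trans r12).
apply: emits_ext (emits_for bnd5 _ R3 bR (neq _ R12) (neq _ bnd12) vvs
  (notin _ R12) (IHvs uvs vs12)) => [s|].
  rewrite expnS
    -(flatten_iota (fun x y => g (assign _ vs (upd s v (nseq x true)) y))).
  have bndE x : upd s v x bnd = s bnd.
    by rewrite /upd eq_sym (negPf (neq _ bnd12)).
  by congr flatten; apply: eq_map => x; rewrite bndE.
exact: leq_trans v12.
Qed.

(** * Binary counters *)

Fixpoint bin_succ (l : seq bool) : seq bool :=
  if l is b :: l' then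
    if b then false :: bin_succ l' else true :: l'
  else [:: true].

Definition bin_of m := iter m bin_succ [::].

Lemma bin_succ_split l : exists a l',
  [/\ l = nseq a true ++ l', ~~ istrue (ohead l') &
  bin_succ l = nseq a false ++ true :: behead l'].
Proof.
elim: l => [|[] l [a [l' [lE hd succE]]]] /=; first by exists 0, [::].
  by exists a.+1, l'; rewrite /= -lE -succE.
by exists 0, (false :: l).
Qed.

Lemma size_bin_of m : size (bin_of m) <= m.
Proof.
elim: m => // m; rewrite /bin_of /=; move: (iter _ _ _) => l lm.
apply: (@leq_trans (size l).+1) => //.
by elim: l {lm} => //= [[]].
Qed.

Lemma binary_cons (b : bool) m : 0 < m -> binary (b + m.*2) = b :: binary m.
Proof.
move=> m0; rewrite /binary trunc_log2S; last by lia.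
have -> : (b + m.*2)./2 = m by rewrite half_bit_double.
apply: (@eq_from_nth _ false) => [|[|i]].
- by rewrite size_mkseq; exact: (congr1 S (esym (size_mkseq _ _))).
- by move=> _; rewrite nth_mkseq // expn0 divn1 oddD odd_double addbF oddb.
rewrite size_mkseq => i_lt.
rewrite -[nth _ (b :: _) _]/(nth false (mkseq _ _) i) !nth_mkseq //.
by rewrite expnS divnMA divn2 half_bit_double.
Qed.

Lemma bit_double_ind (P : nat -> Prop) :
  P 1 -> (forall (b : bool) m, 0 < m -> P m -> P (b + m.*2)) ->
  forall m, 0 < m -> P m.
Proof.
move=> P1 Pdouble; elim/ltn_ind => m IHm m0; have [m1|m1] := leqP m 1.
  by have -> : m = 1 by lia.
by rewrite -(odd_double_half m); apply: Pdouble; [|apply: IHm];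
  rewrite ?half_gt0 // -divn2 ltn_Pdiv.
Qed.

Lemma binary_succ m : 0 < m -> binary m.+1 = bin_succ (binary m).
Proof.
elim/bit_double_ind=> // -[] {}m m0 IHm; last first.
  by rewrite -[_.+1]/(true + m.*2) !binary_cons.
by rewrite -[_.+1]/(false + m.+1.*2) !binary_cons // IHm.
Qed.

Lemma bin_ofE m : 0 < m -> bin_of m = binary m.
Proof.
elim: m => // -[|m] IHm _ //.
by rewrite binary_succ // -IHm.
Qed.

Lemma binary_inj m m' : 0 < m -> 0 < m' -> binary m = binary m' -> m = m'.
Proof.
pose value := foldr (fun (b : bool) x => b + x.*2) 0.
suff binaryK k : 0 < k -> value (binary k) = k.
  by move=> m0 m'0 mm'; rewrite -[LHS]binaryK // mm' binaryK.
elim/bit_double_ind=> // b {}k k0 IHk.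
by rewrite binary_cons // -[LHS]/(b + (value (binary k)).*2) IHk.
Qed.

Definition Pour r (p : test) r' b := While r p (Seq (Pop r) (Push r' b)).

Lemma runs_pour r (p : test) r' b a l s :
  r != r' -> p (Some true) -> ~~ p (ohead l) -> s r = nseq a true ++ l ->
  runs (Pour r p r' b) s (upd (upd s r l) r' (nseq a b ++ s r')) (a * 5).+1.
Proof.
move=> rr' p1 pl sr.
apply: (runs_while (sg := fun i =>
  upd (upd s r (nseq (a - i) true ++ l)) r' (nseq i b ++ s r'))).
- move=> r0; rewrite subn0 -sr /upd.
  by case: eqP => [->|_] //; case: eqP => [->|].
- by rewrite subnn.
- move=> i ia; have ai : a - i = (a - i.+1).+1 by lia.
  split; first by rewrite /upd (negPf rr') eqxx ai.
  apply: runs_ext (runs_seq (runs_pop _ _) (runs_push _ _ _)) => r0.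
  rewrite /upd !eqxx [r' == r]eq_sym (negPf rr') ai /=.
  by case: (r0 =P r') => // _; case: (r0 =P r).
- by rewrite /upd (negPf rr') eqxx subnn.
Qed.

Definition Increment :=
  Seq (Pour out_reg istrue 1 true) (Seq (If out_reg nonempty (Pop out_reg) Skip)
    (Seq (Push out_reg true) (Pour 1 nonempty out_reg false))).

Lemma runs_increment s : s 1 = [::] ->
  runs Increment s (upd s out_reg (bin_succ (s out_reg)))
    (size (s out_reg) * 10 + 10).
Proof.
move=> s1; have [a [l [outE hd ->]]] := bin_succ_split (s out_reg).
have a_le : a <= size (s out_reg) by rewrite outE size_cat size_nseq leq_addr.
pose s' x := upd (upd s out_reg x) 1 (nseq a true).
have carry : runs (Pour out_reg istrue 1 true) s (s' l) (a * 5).+1.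
  apply: runs_ext (runs_pour _ _ _ hd outE) => // r.
  by rewrite s1 cats0.
have drop_top :
  runs (If out_reg nonempty (Pop out_reg) Skip) (s' l) (s' (behead l)) 3.
  apply: runs_if; rewrite /s' /upd /=; case: ifP => [_|].
    by apply: runs_ext (runs_pop _ _); upd_cases.
  by case: (l) => // _; apply: runs_skip.
have set_bit :
  runs (Push out_reg true) (s' (behead l)) (s' (true :: behead l)) 2.
  by apply: runs_ext (runs_push _ _ _); rewrite /s'; upd_cases.
have zeros : runs (Pour 1 nonempty out_reg false) (s' (true :: behead l))
    (upd s out_reg (nseq a false ++ true :: behead l)) (a * 5).+1.
  apply: runs_ext (runs_pour (a := a) (l := [::]) _ _ _ _ _) => //.
    by rewrite /s'; upd_cases; rewrite s1.
  by rewrite cats0.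
apply: runs_le (runs_seq carry (runs_seq drop_top (runs_seq set_bit zeros))) _.
by lia.
Qed.

Definition ToBinary := While tally_reg nonempty (Seq (Pop tally_reg) Increment).

Lemma runs_to_binary s m :
  s out_reg = [::] -> s 1 = [::] -> s tally_reg = nseq m true ->
  runs ToBinary s (upd (upd s out_reg (bin_of m)) tally_reg [::])
    (m * (m * 10 + 13) + 1).
Proof.
move=> s0 s1 s5.
pose sg i := upd (upd s out_reg (bin_of i)) tally_reg (nseq (m - i) true).
apply: (runs_le (n := (m * (1 + (m * 10 + 10)).+2).+1)); last by lia.
apply: (runs_while (sg := sg)).
- by rewrite /sg subn0; upd_cases.
- by rewrite /sg subnn.
- move=> i im; have mi : m - i = (m - i.+1).+1 by lia.
  split; first by rewrite /sg /upd /= mi.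
  apply: runs_seq (runs_pop _ _) _; set s' := upd (sg i) _ _.
  apply: runs_le (runs_ext _ (runs_increment (s1 : s' 1 = [::]))) _.
    by rewrite /s' /sg mi; upd_cases.
  by rewrite -[s' out_reg]/(bin_of i); have := size_bin_of i; lia.
- by rewrite /sg /upd /= subnn.
Qed.

(** * Printing a definable graph *)

Definition poly_runs c (sg sg' : seq bool -> store) :=
  exists2 tau, poly_bounded tau &
    forall w, runs c (sg w) (sg' w) (tau (size w)).

Lemma poly_runs_ext c sg sg' sg'' :
  (forall w, sg' w =1 sg'' w) -> poly_runs c sg sg' -> poly_runs c sg sg''.
Proof.
by move=> e [t pt run]; exists t => // w; apply: runs_ext (e w) (run w).
Qed.

Lemma poly_runs_seq c d sg sg' sg'' :
  poly_runs c sg sg' -> poly_runs d sg' sg'' -> poly_runs (Seq c d) sg sg''.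
Proof.
move=> [t pt runc] [t' pt' rund]; exists (fun x => t x + t' x);
  first by poly_bound.
by move=> w; apply: runs_seq (runc w) (rund w).
Qed.

Lemma poly_runs_emits bnd R vs c g bound sg :
  emits bnd R vs c g -> poly_bounded bound ->
  (forall w, ready bnd R vs (bound (size w)) (sg w)) ->
  poly_runs c sg (fun w => upd (sg w) R (g (sg w) ++ sg w R)).
Proof.
move=> [_ [t pt run]] pb rdy; exists (fun x => t (bound x));
  first exact: poly_bounded_comp.
by move=> w; apply: run.
Qed.

Lemma poly_runs_computable c f sg :
  poly_runs c input_store sg -> (forall w, sg w out_reg = f w) ->
  poly_computable f.
Proof.
move=> [t pt run] sgE; apply: (program_poly_computable (c := c) pt) => w.
by have [n nt ex] := run w; exists (sg w), n.
Qed.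

Notation bits_reg := 6 (only parsing).
Notation base_reg := 8 (only parsing).
Notation side_reg := 9 (only parsing).
Notation origin_reg := 10 (only parsing).
Notation stop_reg := 11 (only parsing).

Definition memory out tally bits base side origin stop : store :=
  nth [::] [:: out; [::]; [::]; [::]; [::]; nseq tally true; bits; [::];
               nseq base true; nseq side true; nseq origin true;
               nseq stop true].

Lemma memory_loop_reg out tally bits base side origin stop r :
  11 < r -> memory out tally bits base side origin stop r = [::].
Proof. by move=> r_gt; rewrite /memory nth_default. Qed.

Ltac memory_cases := let r := fresh "r" in move=> r; rewrite /upd /memory;
  do 12 (case: r => [|r] //=); rewrite ?nth_nil //.

Lemma ready_memory bnd R vs b out tally bits base side origin stop :
  bnd \in [:: base_reg; side_reg] -> all (leq 12) vs ->
  size bits <= b -> base <= b -> side <= b -> origin <= b -> stop <= b ->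
  ready bnd R vs b (memory out tally bits base side origin stop).
Proof.
rewrite !inE => bndE /allP vs12 bits_le base_le side_le origin_le stop_le;
  split=> //.
- by move=> v /vs12; apply: memory_loop_reg.
- move=> i _; rewrite /memory /var_reg.
  by do 6 (case: i => [|i]; first by rewrite /= ?size_nseq); rewrite /= nth_nil.
- by case/orP: bndE => /eqP->; rewrite /memory /= size_nseq.
Qed.

Lemma flatten_const (S T : Type) (x : T) (s : seq S) :
  flatten [seq [:: x] | _ <- s] = nseq (size s) x.
Proof. by rewrite flatten_map1; elim: s => //= _ s ->. Qed.

Lemma flatten_filter (S : Type) (p : pred S) (s : seq S) :
  flatten [seq if p x then [:: true] else [::] | x <- s]
    = nseq (count p s) true.
Proof. by elim: s => //= x s ->; case: (p x). Qed.

Lemma index_iota_add a n k : k < n -> index (a + k) (iota a n) = k.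
Proof.
move=> kn; rewrite -{1}(nth_iota 0 a kn) index_uniq ?size_iota //;
  exact: iota_uniq.
Qed.

Lemma all_iota_ge a b n : b <= a -> all (leq b) (iota a n).
Proof.
move=> ba; apply/allP=> v; rewrite mem_iota => /andP[av _].
exact: leq_trans av.
Qed.

Lemma emits_for_all0 bnd R vs c g :
  5 < bnd < 12 -> R < 12 -> R \notin [:: 1; 2; 3] -> bnd != R ->
  uniq vs -> all (leq 12) vs -> emits bnd R [::] c g ->
  emits bnd R vs (ForAll bnd vs c)
    (fun s => flatten [seq g (assign (size (s bnd)) vs s i)
      | i <- iota 0 (size (s bnd) ^ size vs)]).
Proof.
move=> bnd_var R12 R3 bR uvs vs12 em.
by have := emits_for_all (vs := vs) bnd_var R12 R3 bR _ _ em; rewrite cats0;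
  apply.
Qed.

Section Printer.
Variables (c d D : nat) (phi psi : formula).

Definition base x := x + c.
Definition origin x := base x ^ d.
Definition side x := base x ^ d.+1.
Definition stop x := origin x + x.
Definition vertices x := side x ^ D.
Definition padded w := nseq (origin (size w)) false ++ w.

Definition env x i j (k : nat) : nat :=
  if 6 + D <= k < 6 + D + D then digit (side x) D j (k - (6 + D))
  else if 6 <= k < 6 + D then digit (side x) D i (k - 6)
  else nth 0 [:: stop x; 0; base x; side x; origin x; stop x] k.

Lemma env_const x i j k : k < 6 ->
  env x i j k = nth 0 [:: stop x; 0; base x; side x; origin x; stop x] k.
Proof. by move=> k6; rewrite /env !ifF //; lia. Qed.

Lemma env_fst x i j k : k < D -> env x i j (6 + k) = digit (side x) D i k.
Proof. by move=> kD; rewrite /env ifF ?ifT ?addKn //; lia. Qed.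

Lemma env_snd x i j k : k < D -> env x i j (6 + D + k) = digit (side x) D j k.
Proof. by move=> kD; rewrite /env ifT ?addKn //; lia. Qed.

Definition edge_bit w i j := eval phi (env (size w) i j) (padded w).
Definition vertex_bit w i := eval psi (env (size w) i 0) (padded w).
Definition vertex_count w := count (vertex_bit w) (iota 0 (vertices (size w))).

Definition matrix_bits w :=
  [seq edge_bit w i j | i <- iota 0 (vertices (size w)),
    j <- iota 0 (vertices (size w))].

Definition printed w :=
  nseq (vertices (size w)) true ++ false ::
    matrix_bits w ++ bin_of (vertex_count w).

Definition row_regs := iota 12 D.
Definition col_regs := iota (12 + D) D.

Definition ReadInput := Seq (MoveTo 0 1)
  (Seq (Transfer 1 [:: bits_reg; base_reg; stop_reg]
         (fun r b => (r != bits_reg) || b))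
       (PushOnes c base_reg)).
Definition Power n R b := ForAll base_reg (iota 12 n) (Push R b).
Definition Measure :=
  Seq (Power d origin_reg true) (Seq (Power d.+1 side_reg true)
  (Seq (Power d stop_reg true) (Power d bits_reg false))).
(* Pushing prepends, so the last part of the output is printed first. *)
Definition PrintCount :=
  Seq (ForAll side_reg row_regs (Cond psi (Push tally_reg true) Skip)) ToBinary.
Definition PrintMatrix :=
  ForAll side_reg row_regs
    (ForAll side_reg col_regs
      (Cond phi (Push out_reg true) (Push out_reg false))).
Definition PrintSize :=
  Seq (Push out_reg false) (ForAll side_reg row_regs (Push out_reg true)).

Definition staged bits side origin stop (w : seq bool) : store :=
  let x := size w in memory [::] 0 (bits w) (base x) (side x) (origin x)
    (stop x).
Definition loaded := staged id (fun=> 0) (fun=> 0) id.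
Definition measured out tally w : store := let x := size w in
  memory out tally (padded w) (base x) (side x) (origin x) (stop x).

Definition max_size x := side x + origin x + x + c.

Lemma poly_bounded_side : poly_bounded side.
Proof. by apply: poly_bounded_exp; rewrite /base; poly_bound. Qed.

Lemma poly_bounded_max_size : poly_bounded max_size.
Proof.
rewrite /max_size; do 2 (apply: poly_bounded_add; last by poly_bound).
apply: poly_bounded_add; first exact: poly_bounded_side.
by apply: poly_bounded_exp; rewrite /base; poly_bound.
Qed.

Lemma ready_measured R vs out tally w :
  all (leq 12) vs ->
  ready side_reg R vs (max_size (size w)) (measured out tally w).
Proof.
move=> vs12; rewrite /measured /max_size /stop /base; apply: ready_memory => //;
  try lia.
by rewrite size_cat size_nseq; lia.
Qed.

Lemma poly_runs_read_input : poly_runs ReadInput input_store loaded.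
Proof.
exists (fun x => (x * 7 + 1) + ((x * 11 + 1) + 2 * c)); first by poly_bound.
move=> w; rewrite !addn1.
pose reversed := upd (fun=> [::]) 1 (rev w).
have reverse : runs (MoveTo 0 1) (input_store w) reversed (size w * 7).+1.
  apply: runs_ext (runs_move_to _ _) => // -[|[|r]] //.
  by rewrite /reversed /upd /= cats0.
have copy := @runs_transfer 1 [:: bits_reg; base_reg; stop_reg]
  (fun r b => (r != bits_reg) || b) reversed isT isT.
rewrite -[reversed 1]/(rev w) size_rev /= in copy.
apply: runs_seq reverse _; apply: runs_seq copy _;
  apply: runs_ext (runs_push_ones _ _ _).
have ones : [seq true | _ <- w] = nseq (size w) true by elim: (w) => //= b s ->.
move=> r;
  do 12 (case: r => [|r]; first by rewrite /upd /loaded /staged /memory //=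
  ?cats0 -?map_rev ?revK ?map_id ?ones // -nseqD addnC).
by rewrite /loaded /staged memory_loop_reg.
Qed.

Lemma emits_power n R b :
  R \in [:: bits_reg; side_reg; origin_reg; stop_reg] ->
  emits base_reg R (iota 12 n) (Power n R b)
    (fun s => nseq (size (s base_reg) ^ n) b).
Proof.
rewrite !inE => RE.
have [R12 R3 R8] : [/\ R < 12, R \notin [:: 1; 2; 3] & base_reg != R].
  by case/or4P: RE => /eqP->.
apply: emits_ext (emits_for_all0 _ R12 R3 R8 (iota_uniq _ _) (all_iota_ge _ _)
  (emits_push _ _ _)) => // s.
by rewrite flatten_const !size_iota.
Qed.

Lemma poly_runs_power n R b bits s o e :
  R \in [:: bits_reg; side_reg; origin_reg; stop_reg] ->
  (forall w, size (bits w) <= max_size (size w)) ->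
  (forall x, s x <= max_size x) ->
  (forall x, o x <= max_size x) -> (forall x, e x <= max_size x) ->
  poly_runs (Power n R b) (staged bits s o e)
    (fun w => upd (staged bits s o e w) R
                  (nseq (base (size w) ^ n) b ++ staged bits s o e w R)).
Proof.
move=> RE bits_le s_le o_le e_le.
apply: poly_runs_ext
  (poly_runs_emits (emits_power _ _ RE) poly_bounded_max_size _).
  by move=> w; rewrite {2}/staged /memory /= size_nseq.
move=> w; apply: ready_memory => //; first exact: all_iota_ge.
by rewrite /max_size /base; lia.
Qed.

Lemma poly_runs_measure : poly_runs Measure loaded (measured [::] 0).
Proof.
have [le0 le_id le_origin le_side le_stop] : [/\ forall x, 0 <= max_size x,
    forall x, x <= max_size x, forall x, origin x <= max_size x,
    forall x, side x <= max_size x & forall x, stop x <= max_size x].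
  by split=> x; rewrite /max_size /stop; lia.
apply: (@poly_runs_seq _ _ _ (staged id (fun=> 0) origin id)).
  apply: poly_runs_ext (poly_runs_power _ _ _ _ _ _ _) => // w.
  by rewrite /loaded /staged cats0; memory_cases.
apply: (@poly_runs_seq _ _ _ (staged id side origin id)).
  apply: poly_runs_ext (poly_runs_power _ _ _ _ _ _ _) => // w.
  by rewrite /staged cats0; memory_cases.
apply: (@poly_runs_seq _ _ _ (staged id side origin stop)).
  apply: poly_runs_ext (poly_runs_power _ _ _ _ _ _ _) => // w.
  by rewrite /staged -nseqD; memory_cases.
apply: poly_runs_ext (poly_runs_power _ _ _ _ _ _ _) => // w.
by rewrite /staged; memory_cases.
Qed.

Lemma var_val_memory out tally w k :
  var_val (measured out tally w) k =
  nth 0 [:: stop (size w); 0; base (size w); side (size w); origin (size w);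
    stop (size w)] k.
Proof.
rewrite /var_val /measured /memory /var_reg.
by do 6 (case: k => [|k]; first by rewrite /= ?size_cat ?size_nseq);
  rewrite /= !nth_nil.
Qed.

Lemma var_val_assign2 out tally w i j :
  i < vertices (size w) -> j < vertices (size w) ->
  var_val (assign (side (size w)) col_regs
    (assign (side (size w)) row_regs (measured out tally w) i) j)
    = env (size w) i j.
Proof.
move=> i_lt j_lt; apply/funext=> k;
  rewrite /var_val /env -(var_val_memory out tally).
rewrite !assignE ?iota_uniq ?size_iota // !mem_iota.
have -> : (12 + D <= var_reg k < 12 + D + D) = (6 + D <= k < 6 + D + D).
  by rewrite /var_reg; lia.
have -> : (12 <= var_reg k < 12 + D) = (6 <= k < 6 + D).
  by rewrite /var_reg; lia.
case: ifP => [k_ys|_].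
  have -> : var_reg k = 12 + D + (k - (6 + D)) by rewrite /var_reg; lia.
  by rewrite size_nseq index_iota_add //; lia.
case: ifP => // k_xs.
have -> : var_reg k = 12 + (k - 6) by rewrite /var_reg; lia.
by rewrite size_nseq index_iota_add //; lia.
Qed.

Lemma var_val_assign1 out tally w i : i < vertices (size w) ->
  var_val (assign (side (size w)) row_regs (measured out tally w) i)
    = env (size w) i 0.
Proof.
move=> i_lt; have v0 : 0 < vertices (size w) by apply: leq_ltn_trans i_lt.
rewrite -(var_val_assign2 out tally i_lt v0); apply/funext=> k.
rewrite /var_val.
rewrite [in RHS]assignE ?iota_uniq ?size_iota //; case: ifP => // k_ys.
rewrite assignE ?iota_uniq ?size_iota // size_nseq /digit div0n mod0n.
have k_gt : 11 < var_reg k by move: k_ys; rewrite mem_iota; lia.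
rewrite ifF; first by rewrite /measured memory_loop_reg.
by move: k_ys; rewrite !mem_iota; lia.
Qed.

Lemma eval_edge out w i j : i < vertices (size w) -> j < vertices (size w) ->
  store_eval phi
      (assign (side (size w)) col_regs
        (assign (side (size w)) row_regs (measured out 0 w) i) j)
    = edge_bit w i j.
Proof.
move=> i_lt j_lt; rewrite /store_eval var_val_assign2 // !assign_notin //.
  by rewrite mem_iota.
by rewrite mem_iota addSn.
Qed.

Lemma eval_vertex out tally w i : i < vertices (size w) ->
  store_eval psi (assign (side (size w)) row_regs (measured out tally w) i)
    = vertex_bit w i.
Proof.
by move=> i_lt; rewrite /store_eval var_val_assign1 // assign_notin // mem_iota.
Qed.

Lemma size_side_reg out tally w :
  size (measured out tally w side_reg) = side (size w).
Proof. by rewrite /measured /memory /= size_nseq. Qed.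

Lemma poly_runs_count : poly_runs PrintCount (measured [::] 0)
  (fun w => measured (bin_of (vertex_count w)) 0 w).
Proof.
apply: (@poly_runs_seq _ _ _ (fun w => measured [::] (vertex_count w) w)).
  have emits_tally :=
    emits_for_all0 (bnd := side_reg) (R := tally_reg) (vs :=
      row_regs) isT isT isT isT
    (iota_uniq _ _) (all_iota_ge _ _)
    (emits_cond (R := tally_reg) psi isT
      (emits_push side_reg _ true) (emits_skip _ _)).
  apply: poly_runs_ext (poly_runs_emits (emits_tally isT) poly_bounded_max_size
    _) => w;
    last first.
    exact/ready_measured/all_iota_ge.
  rewrite size_side_reg size_iota.
  rewrite (_ : flatten _ = nseq (vertex_count w) true).
    by rewrite cats0 /measured; memory_cases.
  rewrite -flatten_filter; congr flatten; apply/eq_in_map=> i;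
    rewrite mem_iota => i_lt.
  by rewrite eval_vertex.
exists (fun x => vertices x * (vertices x * 10 + 13) + 1).
  by have pv := poly_bounded_exp D poly_bounded_side; poly_bound.
move=> w.
apply: runs_le (runs_ext _ (runs_to_binary (m := vertex_count w) _ _ _)) _ =>
  //.
  by rewrite /measured; memory_cases.
have count_le : vertex_count w <= vertices (size w).
  by rewrite -[X in _ <= X](size_iota 0) count_size.
by rewrite leq_add2r leq_mul // leq_add2r leq_mul2r.
Qed.

Lemma poly_runs_matrix : poly_runs PrintMatrix
  (fun w => measured (bin_of (vertex_count w)) 0 w)
  (fun w => measured (matrix_bits w ++ bin_of (vertex_count w)) 0 w).
Proof.
have uxy : uniq (row_regs ++ col_regs) by rewrite -iotaD iota_uniq.
have xy12 : all (leq 12) (row_regs ++ col_regs) by rewrite -iotaD all_iota_ge.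
have [uy y12] : uniq col_regs /\ all (leq 12) col_regs.
  by rewrite iota_uniq all_iota_ge // leq_addr.
have emits_row :=
  emits_for_all0 (bnd := side_reg) (R := out_reg) isT isT isT isT uy y12
  (emits_cond (R := out_reg) phi isT
    (emits_push side_reg _ true) (emits_push _ _ false)).
have emits_rows :=
  emits_for_all (bnd := side_reg) (R :=
    out_reg) isT isT isT isT uxy xy12 emits_row.
apply: poly_runs_ext (poly_runs_emits emits_rows poly_bounded_max_size _) => w;
  last first.
  exact: ready_measured.
rewrite size_side_reg !size_iota (_ : flatten _ = matrix_bits w).
  by rewrite /measured; memory_cases.
congr flatten; apply/eq_in_map=> i; rewrite mem_iota => i_lt.
rewrite assign_notin ?mem_iota // size_side_reg -[RHS]flatten_map1.
congr flatten; apply/eq_in_map=> j; rewrite mem_iota => j_lt.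
by rewrite eval_edge //; case: edge_bit.
Qed.

Lemma poly_runs_size : exists2 sg, poly_runs PrintSize
  (fun w => measured (matrix_bits w ++ bin_of (vertex_count w)) 0 w) sg &
  forall w, sg w out_reg = printed w.
Proof.
have emits_ones :=
  emits_for_all0 (bnd := side_reg) (R := out_reg) (vs :=
    row_regs) isT isT isT isT
  (iota_uniq _ _) (all_iota_ge _ _) (emits_push side_reg out_reg true).
eexists.
  apply: (@poly_runs_seq _ _ _
    (fun w =>
       measured (false :: matrix_bits w ++ bin_of (vertex_count w)) 0 w)).
    exists (fun=> 2) => [|w]; first by poly_bound.
    by apply: runs_ext (runs_push _ _ _); rewrite /measured; memory_cases.
  apply: (poly_runs_emits (emits_ones isT) poly_bounded_max_size) => w.
  exact/ready_measured/all_iota_ge.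
by move=> w; rewrite /upd /= size_side_reg flatten_const !size_iota.
Qed.

Theorem printed_poly_computable : poly_computable printed.
Proof.
have [sg print_size sgE] := poly_runs_size.
apply: poly_runs_computable sgE; apply: poly_runs_seq poly_runs_read_input _.
apply: poly_runs_seq poly_runs_measure _.
exact: poly_runs_seq poly_runs_count
  (poly_runs_seq poly_runs_matrix print_size).
Qed.

End Printer.

(** * Definable adjacency *)

Notation zero_var := 1 (only parsing).
Notation side_var := 3 (only parsing).
Notation origin_var := 4 (only parsing).
Notation stop_var := 5 (only parsing).

Definition predicate := (nat -> nat) -> seq bool -> bool.

(* Variable 1 is kept at zero to compare variables with constants. *)
Definition definable (P : predicate) :=
  exists e, forall val bits, val zero_var = 0 -> eval e val bits = P val bits.

Section Definable.
Implicit Types P Q : predicate.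

Lemma definable_ext P Q :
  (forall val bits, val zero_var = 0 -> P val bits = Q val bits) ->
  definable P -> definable Q.
Proof. by move=> PQ [e eP]; exists e => val bits v0; rewrite eP // PQ. Qed.

Lemma definable_const b : definable (fun _ _ => b).
Proof. by case: b; [exists Truth | exists (Neg Truth)]. Qed.

Lemma definable_not P : definable P ->
  definable (fun val bits => ~~ P val bits).
Proof. by case=> e eP; exists (Neg e) => val bits v0 /=; rewrite eP. Qed.

Lemma definable_and P Q :
  definable P -> definable Q ->
  definable (fun val bits => P val bits && Q val bits).
Proof.
by move=> [e eP] [e' eQ]; exists (Conj e e') => val bits v0 /=;
  rewrite eP // eQ.
Qed.

Lemma definable_or P Q :
  definable P -> definable Q ->
  definable (fun val bits => P val bits || Q val bits).
Proof.
move=> dP dQ.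
apply: definable_ext
  (definable_not (definable_and (definable_not dP) (definable_not dQ))).
by move=> val bits _; rewrite negb_and !negbK.
Qed.

Lemma definable_imp P Q :
  definable P -> definable Q ->
  definable (fun val bits => P val bits ==> Q val bits).
Proof.
move=> dP dQ.
apply: definable_ext (definable_or (definable_not dP) dQ) => val bits _.
by rewrite implybE.
Qed.

Lemma definable_all (T : Type) (P : T -> predicate) (l : seq T) :
  (forall x, definable (P x)) ->
  definable (fun val bits => all (fun x => P x val bits) l).
Proof.
by move=> dP; elim: l => [|x l IHl] /=;
  [exact: definable_const | apply: definable_and].
Qed.

Lemma definable_forall (T : finType) (P : T -> predicate) :
  (forall x, definable (P x)) ->
  definable (fun val bits => [forall x, P x val bits]).
Proof.
move=> dP; apply: definable_ext (definable_all (enum T) dP) => val bits _.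
by apply/allP/forallP => [allP x|allP x _]; apply: allP; rewrite mem_enum.
Qed.

Lemma definable_exists (T : finType) (P : T -> predicate) :
  (forall x, definable (P x)) ->
  definable (fun val bits => [exists x, P x val bits]).
Proof.
move=> dP; have dNP x := definable_not (dP x).
apply: definable_ext (definable_not (definable_forall dNP)) => val bits _.
by rewrite negb_forall; apply: eq_existsb => x; rewrite negbK.
Qed.

Lemma definable_lt_add m i n j : definable (fun val _ => m + val i < n + val j).
Proof. by exists (Less m i n j). Qed.

Lemma definable_lt i j : definable (fun val _ => val i < val j).
Proof. exact: (definable_lt_add 0 i 0 j). Qed.

Lemma definable_le i j : definable (fun val _ => val i <= val j).
Proof. exact: (definable_lt_add 0 i 1 j). Qed.

Lemma definable_eq_add m i n j :
  definable (fun val _ => m + val i == n + val j).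
Proof.
have dlt := definable_not (definable_lt_add m i n j).
apply: definable_ext
  (definable_and dlt (definable_not (definable_lt_add n j m i))).
by move=> val bits _; rewrite -!leqNgt eqn_leq andbC.
Qed.

Lemma definable_eq i j : definable (fun val _ => val i == val j).
Proof. exact: (definable_eq_add 0 i 0 j). Qed.

Lemma definable_eq_succ i j : definable (fun val _ => val i == (val j).+1).
Proof. exact: (definable_eq_add 0 i 1 j). Qed.

Lemma definable_eq_const i n : definable (fun val _ => val i == n).
Proof.
by apply: definable_ext (definable_eq_add 0 i n zero_var) => val bits ->;
  rewrite addn0.
Qed.

Lemma definable_bit i : definable (fun val bits => nth false bits (val i)).
Proof. by exists (Bit i). Qed.

Lemma definable_agree J (f f' : nat -> nat) :
  definable (fun val _ => agree J (val \o f) (val \o f')).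
Proof. by apply: definable_forall => k; apply: definable_eq. Qed.

End Definable.

Section DefinableEvents.
Variables (M : TM) (f f' : nat -> nat).

Lemma definable_initial_cell (i : 'I_(extra M).+1) s k :
  definable (fun val bits =>
    s == initial_cell (val origin_var) (val stop_var) bits i (val k)).
Proof.
have d_in : definable (fun val _ =>
    [&& i == ord0, val origin_var <= val k & val k < val stop_var]).
  apply: definable_and; first exact: definable_const.
  by apply: definable_and; [exact: definable_le | exact: definable_lt].
pose in_bit b val bits :=
  [&& i == ord0, val origin_var <= val k & val k < val stop_var]
  && (b == nth false bits (val k)).
have d_in_bit b : definable (in_bit b).
  apply: definable_and d_in _; case: b.
    by apply: definable_ext (definable_bit k) => val bits _; case: nth.
  by apply: definable_ext (definable_not (definable_bit k)) => val bits _;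
    case: nth.
case: s => [[b|x]|].
- apply: definable_ext (d_in_bit b) => val bits _;
    rewrite /in_bit /initial_cell.
  by case: ifP => // _; apply/eqP/eqP => [->|[]].
- by apply: definable_ext (definable_const false) => val bits _;
    rewrite /initial_cell; case: ifP.
- apply: definable_ext (definable_not d_in) => val bits _.
  by rewrite /initial_cell; case: ifP.
Qed.

Lemma definable_valid (z : snapshot M) (g : nat -> nat) :
  definable (fun val bits =>
    valid (val origin_var) (val stop_var) (val side_var) bits
      (event_at z (val \o g))).
Proof.
rewrite /valid /=; apply: definable_and; first exact: definable_const.
apply: definable_and.
  apply: definable_imp; first exact: definable_eq_const.
  apply: definable_and; first exact: definable_const.
  by apply: definable_forall => i; apply: definable_eq.
apply: definable_and.
  apply: definable_imp; last exact: definable_const.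
  exact: (definable_eq_add 1 _ 0).
apply: definable_forall => i; apply: definable_and; first exact: definable_le.
by apply: definable_imp;
  [exact: definable_eq_const | exact: definable_initial_cell].
Qed.

Lemma definable_moved d i j : definable (fun val _ => moved d (val i) (val j)).
Proof.
by case: d;
  [exact: definable_eq_succ | exact: definable_eq | exact: definable_eq_succ].
Qed.

Lemma definable_ordered_compatible (z z' : snapshot M) (g g' : nat -> nat) :
  definable (fun val _ =>
    ordered_compatible (event_at z (val \o g)) (event_at z' (val \o g'))).
Proof.
rewrite /ordered_compatible /compatible /=.
apply: definable_and; first exact: definable_lt.
apply: definable_and; last first.
  by apply: definable_imp; [exact: definable_eq_succ | exact: definable_const].
apply: definable_forall => i; apply: definable_and.
  apply: definable_imp; first exact: definable_eq_succ.
  by apply: definable_and; [exact: definable_eq | exact: definable_const].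
apply: definable_and.
  by apply: definable_imp;
    [exact: definable_le | apply/definable_not/definable_eq].
by apply: definable_imp; [exact: definable_eq_succ | exact: definable_moved].
Qed.

Lemma definable_event_rel :
  definable (fun val bits =>
    event_rel M (val origin_var) (val stop_var) (val side_var) bits (val \o f)
      (val \o f')).
Proof.
apply: definable_exists => z; apply: definable_exists => z'.
do 2 (apply: definable_and; first exact: definable_eq_const).
do 2 (apply: definable_and; first exact: definable_valid).
apply: definable_or; first exact: definable_agree.
by apply: definable_or; apply: definable_ordered_compatible.
Qed.

End DefinableEvents.

(** * The gadget graph in coordinates *)

(* A kind is a class that has forgotten its points. *)
Definition kind := (indep_class unit + clique_class unit)%type.

Definition class_of V (k : kind) (u z : V) : indep_class V + clique_class V :=
  match k with
  | inl (Point _) => inl (Point u)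
  | inl EdgeGate => inl EdgeGate
  | inl TwinGate => inl TwinGate
  | inl PointGate => inl PointGate
  | inl Key => inl Key
  | inr (EdgeOf _ _) => inr (EdgeOf u z)
  | inr (PointOf _) => inr (PointOf u)
  | inr Hub => inr Hub
  end.

Definition kind_of V (c : indep_class V + clique_class V) : kind :=
  match c with
  | inl (Point _) => inl (Point tt)
  | inl EdgeGate => inl EdgeGate
  | inl TwinGate => inl TwinGate
  | inl PointGate => inl PointGate
  | inl Key => inl Key
  | inr (EdgeOf _ _) => inr (EdgeOf tt tt)
  | inr (PointOf _) => inr (PointOf tt)
  | inr Hub => inr Hub
  end.

Definition has_points (V : eqType) (c : indep_class V + clique_class V)
    (u z : V) :=
  match c with
  | inl (Point v) | inr (PointOf v) => u == v
  | inr (EdgeOf v v') => (u == v) && (z == v')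
  | _ => true
  end.

Lemma class_of_eq (V : finType) k (u z : V) c :
  (class_of k u z == c) = (k == kind_of c) && has_points c u z.
Proof.
by case: k c => [[[]||||]|[[] []|[]|]] [[v||||]|[v v'|v|]].
Qed.

Lemma class_link_class_of V W (e : rel V) (e' : rel W) k k'
    u z u' z' a b a' b' :
  symmetric e -> symmetric e' ->
  e u u' = e' a a' -> e u z' = e' a b' -> e z u' = e' b a' ->
  class_link e (class_of k u z) (class_of k' u' z')
    = class_link e' (class_of k a b) (class_of k' a' b').
Proof.
move=> sym sym' uu' uz' zu'.
by case: k k' => [[?||||]|[? ?|?|]] [[?||||]|[? ?|?|]] //=;
  rewrite ?[e u' _]sym ?[e' a' _]sym' ?uu' ?uz' ?zu'.
Qed.

Definition tagged_kinds : seq kind :=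
  [:: inl (Point tt); inl EdgeGate; inl TwinGate; inl PointGate; inl Key;
      inr (EdgeOf tt tt); inr (PointOf tt)].

Definition tag (k : kind) : nat := index k tagged_kinds.

Lemma nth_tagged_kinds t k : k != inr Hub ->
  (nth (inr Hub) tagged_kinds t == k) = (t == tag k).
Proof.
case: k => [[[]||||]|[[] []|[]|]] // _;
  by do 7 (case: t => [//|t]); rewrite nth_default.
Qed.

Section Coordinates.
Variable M : TM.
Local Notation J := (ncoord M).

(* The coordinates of a vertex: its tag, two points, and three numbers that only
   serve to multiply the vertices of a class. *)
Definition dimension := (J + J).+4.
Definition first_point (f : nat -> nat) k := f k.+1.
Definition second_point (f : nat -> nat) k := f (J + k).+1.
Definition copy_index j (f : nat -> nat) := f (J + J + j).+1.

Definition zero (f : nat -> nat) := [forall k : 'I_J, f k == 0].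
Definition axis (f : nat -> nat) :=
  [forall k : 'I_J, (k == 0 :> nat) || (f k == 0)].

Section Adjacency.
Variables (origin stop side : nat) (bits : seq bool).

(* These conditions fix the weights.  With N = side ^ J points, a Point or a
   gate has side ^ 3 * (N - side) vertices, Key has side ^ 2, a PointOf has
   side ^ 3, the EdgeOf of an edge has one, and Hub takes all the rest. *)
Definition fits (k : kind) (f : nat -> nat) : bool :=
  match k with
  | inl (Point _) => ~~ axis (second_point f)
  | inl (EdgeGate | TwinGate | PointGate) =>
      zero (first_point f) && ~~ axis (second_point f)
  | inl Key =>
      [&& zero (first_point f), zero (second_point f) & copy_index 2 f == 0]
  | inr (EdgeOf _ _) =>
      [&& event_rel M origin stop side bits (first_point f) (second_point f),
          copy_index 0 f == 0, copy_index 1 f == 0 & copy_index 2 f == 0]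
  | inr (PointOf _) => zero (second_point f)
  | inr Hub => true
  end.

Definition kind_at (f : nat -> nat) : kind :=
  let k := nth (inr Hub) tagged_kinds (f 0) in if fits k f then k else inr Hub.

Definition class_at f := class_of (kind_at f) (first_point f) (second_point f).

Definition vertex_adj (f f' : nat -> nat) : bool :=
  ~~ agree dimension f f' && class_link (agree J) (class_at f) (class_at f').

Definition in_clique (f : nat -> nat) : bool :=
  if kind_at f is inr _ then true else false.

Lemma kind_atE k f : k != inr Hub ->
  (kind_at f == k) = (f 0 == tag k) && fits k f.
Proof.
move=> kH; rewrite -nth_tagged_kinds // /kind_at; set k' := nth _ _ _.
rewrite eq_sym in kH; have [k'k|/negPf k'k] := eqVneq k' k.
  by rewrite k'k; case: ifP; rewrite ?eqxx // (negPf kH).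
by case: ifP; rewrite ?k'k // (negPf kH).
Qed.

Lemma vertex_adj_sym : symmetric vertex_adj.
Proof.
by move=> f f'; rewrite /vertex_adj agree_sym (class_link_sym (agree_sym J)).
Qed.

Lemma vertex_adj_irr f : vertex_adj f f = false.
Proof. by rewrite /vertex_adj agree_refl. Qed.

Lemma kind_at_ext f f' : (forall k, k < dimension -> f k = f' k) ->
  kind_at f = kind_at f'.
Proof.
move=> ff'; rewrite /kind_at ff' //;
  suff fitsE kd : fits kd f = fits kd f' by rewrite fitsE.
have u_ext k : k < J -> first_point f k = first_point f' k.
  by move=> kJ; apply: ff'; rewrite /dimension; lia.
have z_ext k : k < J -> second_point f k = second_point f' k.
  by move=> kJ; apply: ff'; rewrite /dimension; lia.
have copyE j : j < 3 -> copy_index j f = copy_index j f'.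
  by move=> j3; apply: ff'; rewrite /dimension; lia.
have uE : zero (first_point f) = zero (first_point f').
  by apply: eq_forallb => k; rewrite u_ext.
have zE : zero (second_point f) = zero (second_point f').
  by apply: eq_forallb => k; rewrite z_ext.
have axisE : axis (second_point f) = axis (second_point f').
  by apply: eq_forallb => k; rewrite z_ext.
have relE := eq_event_rel origin stop side bits u_ext z_ext.
by case: kd => [[?||||]|[? ?|?|]] /=; rewrite ?uE ?zE ?axisE ?relE ?copyE.
Qed.

Lemma in_clique_ext f f' :
  (forall k, k < dimension -> f k = f' k) -> in_clique f = in_clique f'.
Proof. by move=> ff'; rewrite /in_clique (kind_at_ext ff'). Qed.

Lemma vertex_adj_ext f f' g g' :
  (forall k, k < dimension -> f k = g k) ->
  (forall k, k < dimension -> f' k = g' k) ->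
  vertex_adj f f' = vertex_adj g g'.
Proof.
move=> fg f'g'.
rewrite /vertex_adj /class_at (kind_at_ext fg) (kind_at_ext f'g').
congr (~~ _ && _); first by apply: eq_forallb => k; rewrite fg ?f'g'.
apply: class_link_class_of; try exact: agree_sym;
  apply: eq_forallb => k; rewrite /first_point /second_point fg ?f'g' //;
  by have := ltn_ord k; rewrite /dimension; lia.
Qed.

End Adjacency.

Section Definability.
Variables (o : nat).
Local Notation at_o val := (fun k => val (o + k)).
Local Notation kind_atv val bits f :=
  (kind_at (val origin_var) (val stop_var) (val side_var) bits f).

Lemma definable_zero g : definable (fun val _ => zero (val \o g)).
Proof. by apply: definable_forall => k; apply: definable_eq_const. Qed.

Lemma definable_axis g : definable (fun val _ => axis (val \o g)).
Proof.
apply: definable_forall => k.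
by apply: definable_or; [exact: definable_const | exact: definable_eq_const].
Qed.

Lemma definable_fits k : definable (fun val bits =>
  fits (val origin_var) (val stop_var) (val side_var) bits k (at_o val)).
Proof.
have zero_u : definable (fun val _ => zero (first_point (at_o val))).
  exact: definable_zero.
have zero_z : definable (fun val _ => zero (second_point (at_o val))).
  exact: definable_zero.
have off_axis : definable (fun val _ => ~~ axis (second_point (at_o val))).
  exact/definable_not/definable_axis.
have copy0 j : definable (fun val _ => copy_index j (at_o val) == 0).
  exact: definable_eq_const.
case: k => [[?||||]|[? ?|?|]] //=.
- exact: definable_and.
- exact: definable_and.
- exact: definable_and.
- exact/(definable_and zero_u)/(definable_and zero_z).
- apply: definable_and; first exact: definable_event_rel.
  by do 2 (apply: definable_and => //).
- exact: definable_const.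
Qed.

Lemma definable_kind_at k :
  definable (fun val bits => kind_atv val bits (at_o val) == k).
Proof.
have tagged k' : k' != inr Hub ->
  definable (fun val bits => kind_atv val bits (at_o val) == k').
  move=> k'H.
  apply: definable_ext (definable_and (definable_eq_const (o + 0) (tag k'))
    (definable_fits k')) => val bits _.
  by rewrite kind_atE.
have [->|] := eqVneq k (inr Hub); last exact: tagged.
pose in_tagged val bits := kind_atv val bits (at_o val) \in tagged_kinds.
apply: (@definable_ext (fun val bits => ~~ in_tagged val bits)).
  by move=> val bits _; rewrite /in_tagged;
    case: kind_at => [[[]||||]|[[] []|[]|]].
apply: definable_not; rewrite /in_tagged.
apply: (@definable_ext (fun val bits =>
  has (fun k' => kind_atv val bits (at_o val) == k') tagged_kinds)).
  move=> val bits _; rewrite -has_pred1; apply: eq_has => k'; exact: eq_sym.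
by do 6 (apply: definable_or; first exact: tagged); apply: definable_or;
  [exact: tagged | exact: definable_const].
Qed.

Lemma definable_in_clique :
  definable (fun val bits => in_clique (val origin_var) (val stop_var)
    (val side_var) bits (at_o val)).
Proof.
apply: (@definable_ext (fun val bits => [exists k : kind,
  (if k is inr _ then true else false) &&
    (kind_atv val bits (at_o val) == k)])).
  move=> val bits _; rewrite /in_clique; set k := kind_at _ _ _ _ _.
  by apply/existsP/idP => [[k' /andP[+ /eqP->]]//|kq]; exists k;
    rewrite kq eqxx.
apply: definable_exists => k; apply: definable_and;
  first exact: definable_const.
exact: definable_kind_at.
Qed.

End Definability.

Lemma definable_vertex_adj o o' : definable (fun val bits =>
  vertex_adj (val origin_var) (val stop_var) (val side_var) bits
    (fun k => val (o + k)) (fun k => val (o' + k))).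
Proof.
apply: definable_and; first exact/definable_not/definable_agree.
pose link_at k k' (val : nat -> nat) := class_link (agree J)
  (class_of k (first_point (fun k => val (o + k)))
    (second_point (fun k => val (o + k))))
  (class_of k' (first_point (fun k => val (o' + k)))
    (second_point (fun k => val (o' + k)))).
have d_link k k' : definable (fun val _ => link_at k k' val).
  case: k k' => [[?||||]|[? ?|?|]] [[?||||]|[? ?|?|]]; rewrite /link_at /=;
  solve [exact: definable_const | exact: definable_agree
        | by apply: definable_or; exact: definable_agree].
pose kd o val bits :=
  kind_at (val origin_var) (val stop_var) (val side_var) bits
  (fun k => val (o + k)).
apply: (@definable_ext (fun val bits => [exists k : kind, exists k' : kind,
  [&& kd o val bits == k, kd o' val bits == k' & link_at k k' val]])).
  move=> val bits _.
  apply/existsP/idP => [[k /existsP[k' /and3P[/eqP<- /eqP<-]]]//|link].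
  by exists (kd o val bits); apply/existsP; exists (kd o' val bits);
    rewrite !eqxx.
apply: definable_exists => k; apply: definable_exists => k'.
do 2 (apply: definable_and; first exact: definable_kind_at).
exact: d_link.
Qed.

End Coordinates.

(** * The reduction *)

Section EventGadget.
Variables (M : TM) (origin stop side : nat) (bits : seq bool).
Hypothesis side_gt7 : 7 < side.
Local Notation J := (ncoord M).
Local Notation D := (dimension M).
Local Notation n := (side ^ D).
Local Notation V := {ffun 'I_J -> 'I_side}.
Local Notation kind_at := (kind_at M origin stop side bits).
Local Notation edge := (@event_edge M origin stop side bits).
Local Notation digits := (digit side D).

Definition event_gadget : sgraph 'I_n :=
  @SGraph _
    (fun i j : 'I_n =>
       vertex_adj M origin stop side bits (digits i) (digits j))
    (fun i j => vertex_adj_sym _ _ _ _ _ _ _)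
    (fun i => vertex_adj_irr _ _ _ _ _ _).

Definition gadget_clique : {set 'I_n} :=
  [set i : 'I_n | in_clique M origin stop side bits (digits i)].

Lemma side_gt0 : 0 < side. Proof. exact: leq_trans side_gt7. Qed.
Definition ord_at (k : nat) : 'I_side := insubd (Ordinal side_gt0) k.
Definition vec (f : nat -> nat) : V := [ffun k : 'I_J => ord_at (f k)].
Definition origin_point : V := vec (fun=> 0).
Definition axis_points : {set V} := [set z | axis M (coords z)].

Lemma digit_lt i k : digits i k < side. Proof. by rewrite ltn_mod side_gt0. Qed.

Lemma val_ord_at k : k < side -> ord_at k = k :> nat.
Proof. by move=> ks; rewrite insubdK. Qed.

Lemma ord_at_eq k l : k < side -> l < side -> (ord_at k == ord_at l) = (k == l).
Proof. by move=> ks ls; rewrite -(inj_eq val_inj) /= !val_ord_at. Qed.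

Lemma coords_vec f k : (forall k, f k < side) -> k < J ->
  coords (vec f) k = f k.
Proof.
by move=> fs kJ; rewrite -[k]/(val (Ordinal kJ)) coords_ord ffunE val_ord_at.
Qed.

Lemma agree_vec f g : (forall k, f k < side) -> (forall k, g k < side) ->
  agree J f g = (vec f == vec g).
Proof.
move=> fs gs; rewrite -agree_coords; apply: eq_forallb => k.
by rewrite !coords_vec.
Qed.

Lemma zero_vec f : (forall k, f k < side) -> zero M f = (vec f == origin_point).
Proof.
by move=> fs; rewrite -agree_vec // => k; apply: side_gt0.
Qed.

Lemma axis_vec f : (forall k, f k < side) -> axis M f = (vec f \in axis_points).
Proof.
by move=> fs; rewrite inE; apply: eq_forallb => k; rewrite coords_vec.
Qed.

Lemma event_rel_vec f g : (forall k, f k < side) -> (forall k, g k < side) ->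
  event_rel M origin stop side bits f g = edge (vec f) (vec g).
Proof. by move=> fs gs; apply: eq_event_rel => k kJ; rewrite coords_vec. Qed.

Lemma card_points : #|{: V}| = side ^ J.
Proof. by rewrite card_ffun !card_ord. Qed.

Lemma card_axis_points : #|axis_points| = side.
Proof.
pose line (t : 'I_side) : V :=
  [ffun k : 'I_J => if k == 0 :> nat then t else ord_at 0].
have line_inj : injective line by move=> t t' /ffunP/(_ ord0); rewrite !ffunE.
rewrite -[RHS]card_ord -cardsT -(card_imset setT line_inj); apply: eq_card => z.
rewrite inE; apply/forallP/imsetP => [zax|[t _ ->] k]; last first.
  by rewrite coords_ord ffunE; case: eqP => //= _; rewrite val_ord_at ?side_gt0.
exists (z ord0) => //; apply/ffunP => k; rewrite ffunE; have := zax k.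
rewrite coords_ord.
case: eqP => [k0 _|_ /eqP zk]; last first.
  by apply: val_inj; rewrite /= zk val_ord_at ?side_gt0.
by congr (z _); apply: val_inj.
Qed.

Definition split_digits (i : 'I_n) :
  'I_side * V * V * ('I_side * 'I_side * 'I_side) :=
  let f := digits i in
  (ord_at (f 0), vec (first_point f), vec (second_point M f),
   (ord_at (copy_index M 0 f), ord_at (copy_index M 1 f),
    ord_at (copy_index M 2 f))).

Lemma eq_digits (i i' : 'I_n) : agree D (digits i) (digits i') = (i == i').
Proof.
apply/forallP/eqP => [ii'|-> //]; apply: val_inj.
apply: digit_inj (ltn_ord i) (ltn_ord i') _ => k kD.
exact/eqP/(ii' (Ordinal kD)).
Qed.

Lemma split_digits_inj : injective split_digits.
Proof.
move=> i i' [/eqP + /eqP + /eqP + /eqP + /eqP + /eqP].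
rewrite -!agree_vec ?ord_at_eq; do ?by move=> *; apply: digit_lt.
move=> /eqP e0 /forallP eu /forallP ez /eqP e1 /eqP e2 /eqP e3; apply/eqP;
  rewrite -eq_digits.
apply/forallP=> -[[|k] kD]; apply/eqP => //=; rewrite !ltnS in kD.
have [kJ|kJ] := ltnP k J; first exact/eqP/(eu (Ordinal kJ)).
have [kJ2|kJ2] := ltnP k (J + J).
  have zJ : k - J < J by lia.
  by have /eqP := ez (Ordinal zJ); rewrite /second_point /= subnKC.
have [->|[->|->]] : k = J + J + 0 \/ k = J + J + 1 \/ k = J + J + 2 by lia.
- exact: e1.
- exact: e2.
- exact: e3.
Qed.

Lemma split_digits_bij : bijective split_digits.
Proof.
apply: inj_card_bij split_digits_inj _.
rewrite !card_prod card_points !card_ord /dimension.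
have -> : (J + J).+4 = 1 + J + J + (1 + 1 + 1) by lia.
by rewrite !expnD !expn1.
Qed.

Lemma card_box (T : {set 'I_side}) (U Z : {set V})
  (P : {set 'I_side * 'I_side * 'I_side}) :
  #|split_digits @^-1: setX (setX (setX T U) Z) P| = #|T| * #|U| * #|Z| * #|P|.
Proof.
by rewrite on_card_preimset ?cardsX //; apply/onW_bij/split_digits_bij.
Qed.

Definition class_of_vertex (i : 'I_n) : indep_class V + clique_class V :=
  class_of (kind_at (digits i)) (vec (first_point (digits i)))
    (vec (second_point M (digits i))).

Lemma adj_event_gadget i i' :
  adj event_gadget i i' = (i != i') &&
    class_link eq_op (class_of_vertex i) (class_of_vertex i').
Proof.
rewrite /= /vertex_adj eq_digits; congr (~~ _ && _).
apply: class_link_class_of; first exact: agree_sym.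
- exact: eq_sym.
- by apply: agree_vec => k; apply: digit_lt.
- by apply: agree_vec => k; apply: digit_lt.
- by apply: agree_vec => k; apply: digit_lt.
Qed.

Lemma gadget_cliqueE : gadget_clique = clique_part class_of_vertex predT.
Proof.
apply/setP=> i; rewrite !inE /in_clique /class_of_vertex.
by case: kind_at => [[?||||]|[? ?|?|]].
Qed.

Local Notation fits := (fits M origin stop side bits).

Definition belongs (c : indep_class V + clique_class V) (i : 'I_n) : bool :=
  fits (kind_of c) (digits i) &&
  has_points c (vec (first_point (digits i))) (vec (second_point M (digits i))).

Lemma class_of_vertex_eq i c : kind_of c != inr Hub ->
  (class_of_vertex i == c) =
  (ord_at (digits i 0) == ord_at (tag (kind_of c))) && belongs c i.
Proof.
move=> cH; rewrite class_of_eq kind_atE // -andbA ord_at_eq ?digit_lt //.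
exact: leq_ltn_trans (index_size (kind_of c) tagged_kinds) side_gt7.
Qed.

Local Notation L := (side ^ 3 * (side ^ J - side)).
Local Notation wt := (weight class_of_vertex).

Lemma card_off_axis : #|~: axis_points| = side ^ J - side.
Proof. by rewrite cardsCs setCK card_axis_points card_points. Qed.

Lemma card_copies : #|[set: 'I_side * 'I_side * 'I_side]| = side ^ 3.
Proof. by rewrite cardsT !card_prod card_ord expnSr mulnn. Qed.

Lemma weight_box c (U Z : {set V}) (P : {set 'I_side * 'I_side * 'I_side}) :
  kind_of c != inr Hub ->
  (forall i, belongs c i = [&& vec (first_point (digits i)) \in U,
     vec (second_point M (digits i)) \in Z & (split_digits i).2 \in P]) ->
  wt c = #|U| * #|Z| * #|P|.
Proof.
move=> cH cE.
rewrite -(mul1n #|U|) -(cards1 (ord_at (tag (kind_of c)))) -card_box.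
by apply: eq_card => i; rewrite !inE class_of_vertex_eq // cE -!andbA.
Qed.

Lemma weight_Point v : wt (inl (Point v)) = L.
Proof.
rewrite (@weight_box _ [set v] (~: axis_points) setT) ?cards1 //.
  by rewrite card_off_axis card_copies mul1n mulnC.
move=> i; rewrite /belongs /= !inE axis_vec ?inE => [|k]; last exact: digit_lt.
by rewrite andbT andbC.
Qed.

Lemma weight_gate o : o \in [:: EdgeGate; TwinGate; PointGate] ->
  wt (inl o) = L.
Proof.
move=> oG.
rewrite (@weight_box _ [set origin_point] (~: axis_points) setT) ?cards1.
- by rewrite card_off_axis card_copies mul1n mulnC.
- by case: o oG.
move=> i; have -> : belongs (inl o) i =
    zero M (first_point (digits i)) && ~~ axis M (second_point M (digits i)).
  by case: o oG => //; rewrite /belongs /= andbT.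
by rewrite zero_vec ?axis_vec ?inE ?andbT // => k; apply: digit_lt.
Qed.

Lemma weight_vertex_indep o : o != Key -> wt (inl o) = L.
Proof. by case: o => [v||||] // _; rewrite ?weight_Point // weight_gate. Qed.

Lemma weight_vertex_Key : wt (inl Key) = side ^ 2.
Proof.
rewrite (@weight_box _ [set origin_point] [set origin_point]
  (setX setT [set ord_at 0])) //.
  by rewrite !cards1 cardsX cards1 cardsT card_prod card_ord !mul1n muln1.
move=> i; rewrite /belongs /= !inE !zero_vec; try by move=> k; apply: digit_lt.
by rewrite ord_at_eq ?digit_lt ?side_gt0 // andbT.
Qed.

Lemma weight_vertex_PointOf v : wt (inr (PointOf v)) = side ^ 3.
Proof.
rewrite (@weight_box _ [set v] [set origin_point] setT) ?cards1 //.
  by rewrite card_copies !mul1n.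
move=> i; rewrite /belongs /= !inE zero_vec => [|k]; last exact: digit_lt.
by rewrite andbT andbC.
Qed.

Lemma weight_vertex_EdgeOf u v : wt (inr (EdgeOf u v)) = edge u v.
Proof.
pose only u (b : bool) : {set V} := if b then [set u] else set0.
rewrite (@weight_box _ (only u (edge u v)) [set v]
  (setX (setX [set ord_at 0] [set ord_at 0]) [set ord_at 0])) //.
  by rewrite !cardsX !cards1 !muln1 /only; case: edge; rewrite ?cards1 ?cards0.
move=> i; rewrite /belongs /= !inE /only !ord_at_eq ?digit_lt ?side_gt0 //.
rewrite event_rel_vec; try by move=> k; apply: digit_lt.
have [<-|nu] := eqVneq (vec (first_point (digits i))) u; last first.
  by rewrite !andbF; case: edge; rewrite ?inE ?(negPf nu).
have [<-|nv] := eqVneq (vec (second_point M (digits i))) v;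
  last by rewrite !andbF.
by case: edge; rewrite ?in_set1 ?in_set0 ?eqxx //= !andbT andbA.
Qed.

Lemma weight_vertex_Hub : L <= wt (inr Hub).
Proof.
have -> : L = #|split_digits @^-1:
    setX (setX (setX [set ord_at 7] [set origin_point]) (~: axis_points)) setT|.
  by rewrite card_box !cards1 card_off_axis card_copies !mul1n mulnC.
apply: subset_leq_card; apply/subsetP=> i; rewrite !inE -!andbA.
rewrite ord_at_eq ?digit_lt // => /andP[/eqP tag7 _].
by rewrite class_of_eq /kind_at tag7 /=.
Qed.

Theorem event_gadget_winnable :
  winnable event_gadget #|gadget_clique| <->
  exists2 U : {set V}, #|U| <= side & side * side <= #|edges_within edge U|.
Proof.
have side0 := side_gt0; have side1 : 1 < side by apply: leq_trans side_gt7.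
have lt_points : side < side ^ J by rewrite -[X in X < _]expn1 ltn_exp2l.
rewrite gadget_cliqueE mulnn.
apply: (winnable_gadget adj_event_gadget weight_vertex_indep weight_vertex_Key
  weight_vertex_EdgeOf weight_vertex_PointOf weight_vertex_Hub);
    rewrite ?card_points //.
- by rewrite expn_gt0 side0.
- by rewrite leq_exp2l.
- apply: (@leq_trans (side ^ 3)); last by rewrite leq_pmulr ?subn_gt0.
  by rewrite -muln2 (expnSr _ 2) leq_mul2l side1 orbT.
Qed.

Lemma gadget_clique_gt0 : 0 < #|gadget_clique|.
Proof.
have /card_gt0P[i] : 0 < wt (inr Hub).
  apply: leq_trans weight_vertex_Hub.
  rewrite muln_gt0 expn_gt0 side_gt0 subn_gt0.
  by rewrite -[X in X < _]expn1 ltn_exp2l // (leq_trans _ side_gt7).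
rewrite inE => /eqP iH; apply/card_gt0P; exists i.
by rewrite gadget_cliqueE inE iH.
Qed.

End EventGadget.

Lemma ones_false_inj n n' (r r' : seq bool) :
  nseq n true ++ false :: r = nseq n' true ++ false :: r' -> n = n' /\ r = r'.
Proof.
elim: n n' => [|n IHn] [|n'] //=; first by case.
by case=> /IHn [-> ->].
Qed.

Lemma sgraph_ext (V : finType) (G G' : sgraph V) : adj G =2 adj G' -> G = G'.
Proof.
case: G G' => [a s i] [a' s' i'] /= aa'.
have {}aa' : a = a' by apply/funext => x; apply/funext => y; apply: aa'.
by move: s i s' i'; rewrite aa' => *; congr SGraph; apply: Prop_irrelevance.
Qed.

Lemma encode_inj n n' (G : sgraph 'I_n) (G' : sgraph 'I_n') m m' :
  0 < m -> 0 < m' -> encode G m = encode G' m' ->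
  exists nn' : n = n', eq_rect n (fun k => sgraph 'I_k) G n' nn' = G' /\ m = m'.
Proof.
move=> m0 m'0 /ones_false_inj [nn']; subst n'.
move/eqP; rewrite eqseq_cat ?size_allpairs // => /andP[/eqP GG' /eqP mm'].
exists erefl; split; last exact: binary_inj.
by apply: sgraph_ext => i j; move/eq_in_allpairs: GG'; apply; rewrite mem_enum.
Qed.

Lemma FireFighting_encode n (G : sgraph 'I_n) m : 0 < m ->
  FireFighting (encode G m) <-> winnable G m.
Proof.
move=> m0; rewrite -ffn_leP; split=> [[n' [G' [m' [m'0 e le]]]]|le];
  last by exists n, G, m.
by have [nn' [GG' mm']] := encode_inj m0 m'0 e; subst n'; move: le;
  rewrite -GG' -mm'.
Qed.

Lemma count_iota_ord n (P : pred nat) :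
  count P (iota 0 n) = #|[set i : 'I_n | P i]|.
Proof. by rewrite -val_enum_ord count_map -size_filter cardsE cardE enumT. Qed.

Section Reduction.
Variables (M : TM) (c d : nat) (w : seq bool).
Hypothesis c_big : #|{: snapshot M}| + 7 < c.
Local Notation x := (size w).
Local Notation D := (dimension M).
Local Notation side := (side c d x).
Local Notation origin := (origin c d x).
Local Notation stop := (stop c d x).
Local Notation bits := (padded c d w).
Local Notation graph := (event_gadget M origin stop side bits).
Local Notation clique := (gadget_clique M origin stop side bits).

Lemma origin_gt0 : 0 < origin.
Proof. by rewrite expn_gt0 /base; lia. Qed.

Lemma side_origin : side = base c x * origin.
Proof. exact: expnS. Qed.

Lemma base_le_side : base c x <= side.
Proof. by rewrite side_origin leq_pmulr ?origin_gt0. Qed.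

Lemma side_gt7 : 7 < side.
Proof. by apply: leq_trans base_le_side; rewrite /base; lia. Qed.

Lemma accepts_winnable T :
  (forall n e, steps n (init M w) e -> n <= T) -> T <= origin ->
  accepts M w <-> winnable graph #|clique|.
Proof.
move=> time_le T_origin; rewrite event_gadget_winnable; last exact: side_gt7.
split=> [|[U Us EU]]; last exact: clique_accepts (side_gt0 side_gt7) Us EU.
apply: (accepts_clique time_le T_origin).
  have : 2 * origin < side; last by lia.
  by rewrite side_origin ltn_pmul2r ?origin_gt0 // /base; lia.
by apply: leq_trans base_le_side; rewrite /base; lia.
Qed.

Variables phi psi : formula.
Hypothesis phiE : forall val bits, val zero_var = 0 ->
  eval phi val bits
    = vertex_adj M (val origin_var) (val stop_var) (val side_var) bits
    (fun k => val (6 + k)) (fun k => val (6 + D + k)).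
Hypothesis psiE : forall val bits, val zero_var = 0 ->
  eval psi val bits
    = in_clique M (val origin_var) (val stop_var) (val side_var) bits
    (fun k => val (6 + k)).

Lemma edge_bitE i j :
  edge_bit c d D phi w i j =
  vertex_adj M origin stop side bits (digit side D i) (digit side D j).
Proof.
rewrite /edge_bit phiE ?env_const //.
by apply: vertex_adj_ext => k; [apply: env_fst | apply: env_snd].
Qed.

Lemma vertex_bitE i :
  vertex_bit c d D psi w i = in_clique M origin stop side bits (digit side D i).
Proof.
by rewrite /vertex_bit psiE ?env_const //; apply: in_clique_ext => k;
  apply: env_fst.
Qed.

Lemma vertex_countE : vertex_count c d D psi w = #|clique|.
Proof. by rewrite /vertex_count (eq_count vertex_bitE) count_iota_ord. Qed.

Lemma printed_encode : printed c d D phi psi w = encode graph #|clique|.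
Proof.
have clique_gt0 := gadget_clique_gt0 M origin stop bits side_gt7.
rewrite /printed vertex_countE bin_ofE // /encode; congr (_ ++ _ :: _ ++ _).
rewrite /matrix_bits -val_enum_ord allpairs_mapl allpairs_mapr.
by apply: eq_allpairs => i j; apply: edge_bitE.
Qed.

End Reduction.

Theorem theorem2 : NP_hard FireFighting.
Proof.
move=> L [M [[p time_le] L_accepts]]; have [c0 [d p_le]] := horner_le_power p.
have [phi phiE] := definable_vertex_adj M 6 (6 + dimension M).
have [psi psiE] := definable_in_clique M 6.
pose c := c0 + #|{: snapshot M}| + 8.
have c_big : #|{: snapshot M}| + 7 < c by lia.
exists (printed c d (dimension M) phi psi); split;
  first exact: printed_poly_computable.
move=> w; rewrite L_accepts (printed_encode _ _ c_big phiE psiE).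
have clique_gt0 := gadget_clique_gt0 M _ _ (padded c d w) (side_gt7 d w c_big).
rewrite FireFighting_encode //; apply: (accepts_winnable c_big (time_le w)).
by apply: leq_trans (p_le _) _; apply: leq_exp; rewrite // /base /c; lia.
Qed.
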